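(* Let $(G_1,G_2)$ be a matched pair of affine algebraic groups, and let $\mathfrak g_1$ be the Lie algebra of $G_1$. Then by the action of $U(\mathfrak g_1)$ on $\mathcal P(G_2)$ determined by $X\triangleright f=f^{<0>}X(f^{<1>})$ for $X\in\mathfrak g_1$, $f\in\mathcal P(G_2)$, and the coaction of $\mathcal P(G_2)$ on $U(\mathfrak g_1)$ determined by $\blacktriangledown_{\rm pol}:\mathfrak g_1\to\mathfrak g_1\otimes\mathcal P(G_2)$, $\blacktriangledown_{\rm pol}(X_i)=\sum_jX_j\otimes f^j_i$, where $\psi\triangleright X_i=\sum_jf^j_i(\psi)X_j$ for $\psi\in G_2$, the pair $(U(\mathfrak g_1),\mathcal P(G_2))$ is a matched pair of Hopf algebras.
   Context: Conventions: everything is over $\mathbb C$, groups are connected. Sweedler notation $\Delta(h)=h_{(1)}\otimes h_{(2)}$, right coactions $u\mapsto u_{<0>}\otimes u_{<1>}$. $\mathcal P(G)$ is the commutative Hopf algebra of polynomial functions on an affine algebraic group $G$ (pointwise product, $\Delta(f)(\psi_1,\psi_2)=f(\psi_1\psi_2)$, $\varepsilon(f)=f(e)$, $S(f)(\psi)=f(\psi^{-1})$). **Matched pair of affine algebraic groups.** Affine algebraic groups $G_1,G_2$ with morphisms of affine algebraic sets $\triangleright:G_2\times G_1\to G_1$ (a left action of $G_2$) and $\triangleleft:G_2\times G_1\to G_2$ (a right action of $G_1$) such that $\psi\triangleright(\varphi_1\varphi_2)=(\psi\triangleright\varphi_1)((\psi\triangleleft\varphi_1)\triangleright\varphi_2)$,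 $\psi\triangleright e=e$, $(\psi_1\psi_2)\triangleleft\varphi=(\psi_1\triangleleft(\psi_2\triangleright\varphi))(\psi_2\triangleleft\varphi)$, $e\triangleleft\varphi=e$. For $f\in\mathcal P(G_2)$ write $f^{<0>}\otimes f^{<1>}\in\mathcal P(G_2)\otimes\mathcal P(G_1)$ for the element with $f^{<0>}(\psi)f^{<1>}(\varphi)=f(\psi\triangleleft\varphi)$. Elements $X\in\mathfrak g_1$ are viewed as point derivations of $\mathcal P(G_1)$ at the identity. The action of $G_2$ on $\mathfrak g_1$ is the differential of $\varphi\mapsto\psi\triangleright\varphi$ at $e$: $(\psi\triangleright X)(f)=X(\varphi\mapsto f(\psi\triangleright\varphi))$. $X_1,\dots,X_n$ is a basis of $\mathfrak g_1$; the functions $f_i^j$ lie in $\mathcal P(G_2)$. **Extension of the coaction.** $\blacktriangledown_{\rm pol}$ is extended to $\blacktriangledown:U(\mathfrak g_1)\to U(\mathfrak g_1)\otimes\mathcal P(G_2)$ by $\blacktriangledown(1)=1\otimes1$, $\blacktriangledown(uv)=u_{(1)<0>}v_{<0>}\otimes u_{(1)<1>}(u_{(2)}\triangleright v_{<1>})$. **Matched pair of Hopf algebras.** Hopf algebras $\mathcal U,\mathcal F$ form a matched pair if $\mathcal F$ is a left $\mathcal U$-module algebra, $\mathcal U$ is a right $\mathcal F$-comodule coalgebra ($u_{<0>(1)}\otimes u_{<0>(2)}\otimes u_{<1>}=u_{(1)<0>}\otimes u_{(2)<0>}\otimes u_{(1)<1>}u_{(2)<1>}$, $\varepsilon(u_{<0>})u_{<1>}=\varepsilon(u)1$),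 and for all $u,v\in\mathcal U$, $f\in\mathcal F$: $\varepsilon(u\triangleright f)=\varepsilon(u)\varepsilon(f)$; $\Delta(u\triangleright f)=u_{(1)<0>}\triangleright f_{(1)}\otimes u_{(1)<1>}(u_{(2)}\triangleright f_{(2)})$; $\blacktriangledown(1)=1\otimes1$; $\blacktriangledown(uv)=u_{(1)<0>}v_{<0>}\otimes u_{(1)<1>}(u_{(2)}\triangleright v_{<1>})$; $u_{(2)<0>}\otimes(u_{(1)}\triangleright f)u_{(2)<1>}=u_{(1)<0>}\otimes u_{(1)<1>}(u_{(2)}\triangleright f)$. *)

(* Defs.v *)
From HB Require Import structures.
From mathcomp Require Import all_boot all_order all_algebra.
From mathcomp Require Import boolp classical_sets mpoly ring.

Set Implicit Arguments.
Unset Strict Implicit.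
Unset Printing Implicit Defensive.

Import GRing.Theory.
Local Open Scope quotient_scope.
Local Open Scope ring_scope.

(* [:: (v1, w1); ...; (vk, wk)] stands for the formal sum of the vi ⊗ wi. *)
Inductive tensor_eq (K : fieldType) (V W : lmodType K) :
    seq (V * W) -> seq (V * W) -> Prop :=
| TensorPerm s t : perm_eq s t -> tensor_eq s t
| TensorSym s t : tensor_eq s t -> tensor_eq t s
| TensorTrans s t u : tensor_eq s t -> tensor_eq t u -> tensor_eq s u
| TensorCat s s' t t' :
    tensor_eq s s' -> tensor_eq t t' -> tensor_eq (s ++ t) (s' ++ t')
| TensorAddl v v' w : tensor_eq [:: (v + v', w)] [:: (v, w); (v', w)]
| TensorAddr v w w' : tensor_eq [:: (v, w + w')] [:: (v, w); (v, w')]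
| TensorScale a v w : tensor_eq [:: (a *: v, w)] [:: (v, a *: w)]
| Tensor0 w : tensor_eq [:: (0, w)] [::].

Section Tensor.
Variables (K : fieldType) (V W : lmodType K).
Implicit Types (s t : seq (V * W)) (v : V) (w : W).

Let teq s t : bool := `[< tensor_eq s t >].

Let teq_refl : reflexive teq.
Proof. by move=> s; apply/asboolP/TensorPerm. Qed.

Let teq_sym : ssrbool.symmetric teq.
Proof. by move=> s t; apply/asboolP/asboolP; apply: TensorSym. Qed.

Let teq_trans : transitive teq.
Proof.
by move=> t s u /asboolP st /asboolP tu; apply/asboolP/(TensorTrans st tu).
Qed.

Definition tensor_rel := EquivRel teq teq_refl teq_sym teq_trans.
Definition tensor : Type := {eq_quot tensor_rel}.
HB.instance Definition _ := Choice.on tensor.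
HB.instance Definition _ := EqQuotient.on tensor.

Lemma tensor_piP s t : reflect (tensor_eq s t) (\pi_tensor s == \pi_tensor t).
Proof. by rewrite eqmodE /=; apply: asboolP. Qed.

Lemma tensor_piE s t : tensor_eq s t -> \pi_tensor s = \pi_tensor t.
Proof. by move=> st; apply/eqP/tensor_piP. Qed.

Lemma tensor_repr s : tensor_eq (repr (\pi_tensor s)) s.
Proof. by apply/tensor_piP; rewrite reprK. Qed.

Definition tens v w : tensor := \pi_tensor [:: (v, w)].

Definition tensor_zero : tensor := \pi_tensor [::].
Definition tensor_add (x y : tensor) : tensor := \pi_tensor (repr x ++ repr y).
Definition tensor_scale (a : K) (x : tensor) : tensor :=
  \pi_tensor [seq (a *: p.1, p.2) | p <- repr x].

Let saddE s t : tensor_add (\pi_tensor s) (\pi_tensor t) = \pi_tensor (s ++ t).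
Proof. by apply: tensor_piE; apply: TensorCat; apply: tensor_repr. Qed.

Lemma tensor_eq_scale a s t : tensor_eq s t ->
  tensor_eq [seq (a *: p.1, p.2) | p <- s] [seq (a *: p.1, p.2) | p <- t].
Proof.
elim=> {s t} /=.
- by move=> s t st; apply/TensorPerm/perm_map.
- by move=> s t _; apply: TensorSym.
- by move=> s t u _ st _; apply: TensorTrans.
- by move=> s s' t t' _ ss' _ tt'; rewrite !map_cat; apply: TensorCat.
- by move=> v v' w; rewrite scalerDr; apply: TensorAddl.
- by move=> v w w'; apply: TensorAddr.
- by move=> b v w; rewrite scalerA mulrC -scalerA; apply: TensorScale.
- by move=> w; rewrite scaler0; apply: Tensor0.
Qed.

Let sscaleE a s : tensor_scale a (\pi_tensor s) =
  \pi_tensor [seq (a *: p.1, p.2) | p <- s].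
Proof. by apply/tensor_piE/tensor_eq_scale/tensor_repr. Qed.

Lemma tensor_ind (P : tensor -> Prop) :
  P (\pi_tensor [::]) ->
  (forall v w s, P (\pi_tensor s) -> P (\pi_tensor ((v, w) :: s))) ->
  forall x, P x.
Proof.
move=> P0 PS x; rewrite -[x]reprK.
by elim: (repr x) => [|[v w] s IH] //; apply: PS.
Qed.

Let saddA : associative tensor_add.
Proof.
move=> x y z; elim/quotW: x => x; elim/quotW: y => y; elim/quotW: z => z.
by rewrite (saddE y z) (saddE x y) !saddE catA.
Qed.
Let saddC : commutative tensor_add.
Proof.
move=> x y; elim/quotW: x => x; elim/quotW: y => y; rewrite !saddE.
by apply/tensor_piE/TensorPerm; rewrite perm_catC.
Qed.
Let sadd0 : left_id tensor_zero tensor_add.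
Proof. by move=> x; elim/quotW: x => x; rewrite saddE. Qed.
Let saddN : left_inverse tensor_zero (tensor_scale (-1)) tensor_add.
Proof.
elim/tensor_ind=> [|v w s IH]; rewrite sscaleE saddE //=.
have -> : \pi_tensor ((-1 *: v, w) :: [seq (-1 *: p.1, p.2) | p <- s]
                        ++ (v, w) :: s) =
          tensor_add (\pi_tensor [:: (-1 *: v, w); (v, w)])
               (\pi_tensor ([seq (-1 *: p.1, p.2) | p <- s] ++ s)).
  rewrite saddE; apply/tensor_piE/TensorPerm.
  by rewrite /= perm_cons -cat1s perm_catCA.
have -> : \pi_tensor ([seq (-1 *: p.1, p.2) | p <- s] ++ s) = tensor_zero.
  by rewrite -saddE -sscaleE.
rewrite saddC sadd0; apply: tensor_piE.
apply: TensorTrans (TensorSym (TensorAddl _ _ _)) _.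
by rewrite scaleN1r addNr; apply: Tensor0.
Qed.

HB.instance Definition _ :=
  GRing.isZmodule.Build tensor saddA saddC sadd0 saddN.

Let sscaleA a b x : tensor_scale a (tensor_scale b x) = tensor_scale (a * b) x.
Proof.
elim/quotW: x => x; rewrite (sscaleE b) !sscaleE -map_comp.
congr (\pi _); apply: eq_map => p /=.
by rewrite scalerA.
Qed.
Let sscale1 : left_id 1 tensor_scale.
Proof.
move=> x; elim/quotW: x => x; rewrite sscaleE; congr (\pi _).
by rewrite map_id_in // => -[v w] _; rewrite /= scale1r.
Qed.
Let sscaleDr : right_distributive tensor_scale +%R.
Proof.
move=> a x y; elim/quotW: x => x; elim/quotW: y => y.
rewrite -[_ + _]/(tensor_add _ _) (saddE x y) !sscaleE map_cat.
by rewrite -[RHS]/(tensor_add _ _) saddE.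
Qed.
Let sscaleDl x : {morph tensor_scale^~ x : a b / a + b}.
Proof.
move=> a b; elim/tensor_ind: x => [|v w s IH].
  by rewrite !sscaleE /= [RHS]saddE.
have E c : tensor_scale c (\pi_tensor ((v, w) :: s)) =
           \pi_tensor [:: (c *: v, w)] + tensor_scale c (\pi_tensor s).
  by rewrite !sscaleE [RHS]saddE.
rewrite !E IH addrACA; congr (_ + _); rewrite [RHS]saddE scalerDl.
by apply/tensor_piE/TensorAddl.
Qed.

HB.instance Definition _ :=
  GRing.Zmodule_isLmodule.Build K tensor sscaleA sscale1 sscaleDr sscaleDl.

Lemma tensor0E : 0 = \pi_tensor [::]. Proof. by []. Qed.
Lemma tensorDE s t : \pi_tensor s + \pi_tensor t = \pi_tensor (s ++ t).
Proof. exact: saddE. Qed.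
Lemma tensorZE a s :
  a *: \pi_tensor s = \pi_tensor [seq (a *: p.1, p.2) | p <- s].
Proof. exact: sscaleE. Qed.

Lemma tens_addl v v' w : tens (v + v') w = tens v w + tens v' w.
Proof. by rewrite [RHS]saddE; apply/tensor_piE/TensorAddl. Qed.

Lemma tens_addr v w w' : tens v (w + w') = tens v w + tens v w'.
Proof. by rewrite [RHS]saddE; apply/tensor_piE/TensorAddr. Qed.

Lemma tens_scalel a v w : tens (a *: v) w = a *: tens v w.
Proof. by rewrite [RHS]sscaleE. Qed.

Lemma tens_scaler a v w : tens v (a *: w) = a *: tens v w.
Proof.
by rewrite -tens_scalel; apply/tensor_piE/TensorSym/TensorScale.
Qed.

Lemma tensor_elim (P : tensor -> Prop) :
  (forall v w, P (tens v w)) -> P 0 -> (forall x y, P x -> P y -> P (x + y)) ->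
  forall x, P x.
Proof.
move=> Pt P0 PD; elim/tensor_ind=> // v w s Ps.
by have := PD _ _ (Pt v w) Ps; rewrite tensorDE.
Qed.

Lemma tens_repr (x : tensor) : x = \sum_(p <- repr x) tens p.1 p.2.
Proof.
rewrite -[LHS]reprK; elim: (repr x) => [|[v w] s IH]; first by rewrite big_nil.
by rewrite big_cons -IH [RHS]saddE.
Qed.

End Tensor.

Reserved Notation "\Sw_ ( a , b <- t ) E" (at level 41, E at level 41,
  a name, b name, t at level 35, format "\Sw_ ( a ,  b  <-  t )  E").

Notation "V ⊗ W" := (tensor V W) (at level 40, left associativity) : type_scope.
Notation "v ⊗ w" := (tens v w) (at level 40, left associativity) : ring_scope.

(* The Sweedler sum of f a b over t = a ⊗ b.  It goes through a chosen
   representative of t, so it is meaningful for bilinear f only: see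
   [sweedler_tens]. *)
Definition sweedler (K : fieldType) (V W : lmodType K) (M : zmodType)
  (t : V ⊗ W) (f : V -> W -> M) : M := \sum_(p <- repr t) f p.1 p.2.

Notation "\Sw_ ( a , b <- t ) E" := (sweedler t (fun a b => E)) : ring_scope.

Definition bilinear_map (K : fieldType) (V W M : lmodType K)
    (f : V -> W -> M) : Prop :=
  (forall a v v' w, f (a *: v + v') w = a *: f v w + f v' w) /\
  (forall a v w w', f v (a *: w + w') = a *: f v w + f v w').

Section Sweedler.
Variables (K : fieldType) (V W M : lmodType K).
Implicit Types (f : V -> W -> M).

Lemma tens_bilinear : bilinear_map (@tens K V W).
Proof.
by split=> *; rewrite (tens_addl, tens_addr) (tens_scalel, tens_scaler).
Qed.

Section Bilinear.
Variable f : V -> W -> M.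
Hypothesis bf : bilinear_map f.

Lemma bilinDl v v' w : f (v + v') w = f v w + f v' w.
Proof. by have := bf.1 1 v v' w; rewrite !scale1r. Qed.
Lemma bilinDr v w w' : f v (w + w') = f v w + f v w'.
Proof. by have := bf.2 1 v w w'; rewrite !scale1r. Qed.
Lemma bilin0l w : f 0 w = 0.
Proof. by apply: (addIr (f 0 w)); rewrite -bilinDl !add0r. Qed.
Lemma bilin0r v : f v 0 = 0.
Proof. by apply: (addIr (f v 0)); rewrite -bilinDr !add0r. Qed.
Lemma bilinZl a v w : f (a *: v) w = a *: f v w.
Proof. by have := bf.1 a v 0 w; rewrite bilin0l !addr0. Qed.
Lemma bilinZr a v w : f v (a *: w) = a *: f v w.
Proof. by have := bf.2 a v w 0; rewrite bilin0r !addr0. Qed.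

Lemma sweedler_eq s t : tensor_eq s t ->
  \sum_(p <- s) f p.1 p.2 = \sum_(p <- t) f p.1 p.2.
Proof.
elim=> {s t}.
- by move=> s t st; rewrite (perm_big _ st).
- by move=> s t _ ->.
- by move=> s t u _ -> _ ->.
- by move=> s s' t t' _ ss' _ tt'; rewrite !big_cat /= ss' tt'.
- by move=> v v' w; rewrite !big_cons !big_nil !addr0 bilinDl.
- by move=> v w w'; rewrite !big_cons !big_nil !addr0 bilinDr.
- by move=> a v w; rewrite !big_cons !big_nil !addr0 bilinZl bilinZr.
- by move=> w; rewrite big_cons !big_nil addr0 bilin0l.
Qed.

Lemma sweedler_pi s :
  sweedler (\pi_(V ⊗ W) s) f = \sum_(p <- s) f p.1 p.2.
Proof. exact/sweedler_eq/tensor_repr. Qed.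

Lemma sweedler_tens v w : \Sw_(a, b <- v ⊗ w) f a b = f v w.
Proof. by rewrite sweedler_pi big_seq1. Qed.

Lemma sweedler_linear : linear (fun t : V ⊗ W => sweedler t f).
Proof.
move=> a x y; elim/quotW: x => x; elim/quotW: y => y.
rewrite tensorZE tensorDE !sweedler_pi.
rewrite big_cat big_map /= scaler_sumr; congr (_ + _).
by apply: eq_bigr => p _; rewrite bilinZl.
Qed.

Lemma sweedlerD x y : sweedler (x + y) f = sweedler x f + sweedler y f.
Proof. by have := sweedler_linear 1 x y; rewrite !scale1r. Qed.

Lemma sweedlerZ a x : sweedler (a *: x) f = a *: sweedler x f.
Proof.
have f0 : sweedler 0 f = 0 by rewrite tensor0E sweedler_pi big_nil.
by have := sweedler_linear a x 0; rewrite f0 !addr0.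
Qed.

End Bilinear.

(* Along with [tens_bilinear], [sweedler_tens] and [sweedler_linear] this is
   the universal property of the tensor product. *)
Lemma tensor_ext (f g : V ⊗ W -> M) :
  linear f -> linear g -> (forall v w, f (v ⊗ w) = g (v ⊗ w)) -> f =1 g.
Proof.
move=> lf lg fg x; rewrite [x]tens_repr.
have L (h : V ⊗ W -> M) : linear h -> forall s,
    h (\sum_(p <- s) p.1 ⊗ p.2) = \sum_(p <- s) h (p.1 ⊗ p.2).
  move=> lh; have h0 : h 0 = 0.
    by have := lh (-1) 0 0; rewrite scaler0 add0r scaleN1r addNr.
  elim=> [|p s IH]; first by rewrite !big_nil.
  by rewrite !big_cons -[_ ⊗ _]scale1r lh !scale1r IH.
by rewrite !L //; apply: eq_bigr => p _; apply: fg.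
Qed.

End Sweedler.

Definition tensor_mul (K : fieldType) (A B : algType K) (x y : A ⊗ B) : A ⊗ B :=
  \Sw_(a, b <- x) \Sw_(c, d <- y) (a * c) ⊗ (b * d).

Section TensorAlgebra.
Variables (K : fieldType) (A B : algType K).

Let bil_in (a : A) (b : B) :
  bilinear_map (fun c d => (a * c) ⊗ (b * d) : A ⊗ B).
Proof.
by split=> *; rewrite mulrDr -scalerAr ?tens_addl ?tens_addr
  ?tens_scalel ?tens_scaler.
Qed.

Lemma bil_sweedler (V1 W1 V2 W2 M : lmodType K)
    (f : V1 -> W1 -> V2 -> W2 -> M) t :
  (forall c d, bilinear_map (fun a b => f a b c d)) ->
  bilinear_map (fun a b => \Sw_(c, d <- t) f a b c d).
Proof.
move=> bf; split=> a v v' w; rewrite /sweedler scaler_sumr -big_split /=.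
  by apply: eq_bigr => p _; rewrite (bf _ _).1.
by apply: eq_bigr => p _; rewrite (bf _ _).2.
Qed.

Let bil_out (y : A ⊗ B) :
  bilinear_map (fun a b => \Sw_(c, d <- y) (a * c) ⊗ (b * d) : A ⊗ B).
Proof.
apply: bil_sweedler => c d.
by split=> *; rewrite mulrDl -scalerAl ?tens_addl ?tens_addr
  ?tens_scalel ?tens_scaler.
Qed.

Lemma tensor_mulE a b c d :
  tensor_mul (a ⊗ b) (c ⊗ d) = (a * c) ⊗ (b * d) :> A ⊗ B.
Proof. by rewrite /tensor_mul (sweedler_tens (bil_out _)) sweedler_tens. Qed.

Let mulDl : left_distributive (@tensor_mul K A B) +%R.
Proof. by move=> x y z; rewrite /tensor_mul (sweedlerD (bil_out _)). Qed.

Let mulDr : right_distributive (@tensor_mul K A B) +%R.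
Proof.
move=> x y z; rewrite /tensor_mul {1 3 5}/sweedler -big_split /=.
by apply: eq_bigr => p _; rewrite sweedlerD.
Qed.

Let mul0t : left_zero 0 (@tensor_mul K A B).
Proof. by move=> x; apply: (addIr (tensor_mul 0 x)); rewrite -mulDl !add0r. Qed.

Let mult0 : right_zero 0 (@tensor_mul K A B).
Proof. by move=> x; apply: (addIr (tensor_mul x 0)); rewrite -mulDr !add0r. Qed.

Let mulA : associative (@tensor_mul K A B).
Proof.
move=> x y z; elim/tensor_elim: x => [a a'||x x' IH IH'].
- elim/tensor_elim: y => [b b'||y y' IH IH'].
  + elim/tensor_elim: z => [c c'||z z' IH IH'].
    * by rewrite !tensor_mulE !mulrA.
    * by rewrite !mult0.
    * by rewrite !mulDr IH IH'.
  + by rewrite mul0t mult0 mul0t.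
  + by rewrite mulDl !mulDr mulDl IH IH'.
- by rewrite !mul0t.
- by rewrite !mulDl IH IH'.
Qed.

Let mul1t : left_id (1 ⊗ 1) (@tensor_mul K A B).
Proof.
move=> x; elim/tensor_elim: x => [a a'||x x' IH IH'].
- by rewrite tensor_mulE !mul1r.
- by rewrite mult0.
- by rewrite mulDr IH IH'.
Qed.

Let mult1 : right_id (1 ⊗ 1) (@tensor_mul K A B).
Proof.
move=> x; elim/tensor_elim: x => [a a'||x x' IH IH'].
- by rewrite tensor_mulE !mulr1.
- by rewrite mul0t.
- by rewrite mulDl IH IH'.
Qed.

HB.instance Definition _ := GRing.Zmodule_isPzRing.Build (tensor A B)
  mulA mul1t mult1 mulDl mulDr.

Lemma tens1E : 1 = 1 ⊗ 1 :> A ⊗ B. Proof. by []. Qed.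

Lemma tensM a b c d : (a ⊗ b) * (c ⊗ d) = (a * c) ⊗ (b * d) :> A ⊗ B.
Proof. exact: tensor_mulE. Qed.

Lemma tensor_scaleAl k (x y : A ⊗ B) : k *: (x * y) = (k *: x) * y.
Proof. by rewrite [RHS](sweedlerZ (bil_out _)). Qed.

Lemma tensor_scaleAr k (x y : A ⊗ B) : k *: (x * y) = x * (k *: y).
Proof.
rewrite /GRing.mul /= /tensor_mul {1 3}/sweedler scaler_sumr.
by apply: eq_bigr => p _; rewrite sweedlerZ.
Qed.

End TensorAlgebra.

HB.mixin Record Lmodule_isLie (K : fieldType) g of GRing.Lmodule K g := {
  lie_bracket : g -> g -> g;
  lie_bracket_bilinear : bilinear_map lie_bracket;
  lie_bracketxx : forall x, lie_bracket x x = 0;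
  lie_jacobi : forall x y z, lie_bracket x (lie_bracket y z) +
    lie_bracket y (lie_bracket z x) + lie_bracket z (lie_bracket x y) = 0
}.

#[short(type="lieAlgType")]
HB.structure Definition LieAlgebra (K : fieldType) :=
  {g of GRing.Lmodule K g & Lmodule_isLie K g}.

(* U(g) by generators and relations: noncommutative polynomial expressions in
   the elements of g, modulo the axioms of unital associative K-algebras, the
   linearity of the generators, and xy - yx = [x, y]. *)
Inductive env_term (K : fieldType) (g : lieAlgType K) : Type :=
| EnvGen of g
| EnvConst of K
| EnvAdd of env_term g & env_term g
| EnvMul of env_term g & env_term g.

Arguments EnvGen {K g} _.
Arguments EnvConst {K g} _.

Inductive env_eq (K : fieldType) (g : lieAlgType K) :
    env_term g -> env_term g -> Prop :=
| EnvRefl s : env_eq s s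
| EnvSym s t : env_eq s t -> env_eq t s
| EnvTrans s t u : env_eq s t -> env_eq t u -> env_eq s u
| EnvAddCongr s s' t t' :
    env_eq s s' -> env_eq t t' -> env_eq (EnvAdd s t) (EnvAdd s' t')
| EnvMulCongr s s' t t' :
    env_eq s s' -> env_eq t t' -> env_eq (EnvMul s t) (EnvMul s' t')
| EnvAddA s t u : env_eq (EnvAdd s (EnvAdd t u)) (EnvAdd (EnvAdd s t) u)
| EnvAddC s t : env_eq (EnvAdd s t) (EnvAdd t s)
| EnvAdd0 s : env_eq (EnvAdd (EnvConst 0) s) s
| EnvMulA s t u : env_eq (EnvMul s (EnvMul t u)) (EnvMul (EnvMul s t) u)
| EnvMul1 s : env_eq (EnvMul (EnvConst 1) s) s
| EnvMulDl s t u :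
    env_eq (EnvMul (EnvAdd s t) u) (EnvAdd (EnvMul s u) (EnvMul t u))
| EnvMulDr s t u :
    env_eq (EnvMul s (EnvAdd t u)) (EnvAdd (EnvMul s t) (EnvMul s u))
| EnvConstD a b : env_eq (EnvConst (a + b)) (EnvAdd (EnvConst a) (EnvConst b))
| EnvConstM a b : env_eq (EnvConst (a * b)) (EnvMul (EnvConst a) (EnvConst b))
| EnvConstC a s : env_eq (EnvMul (EnvConst a) s) (EnvMul s (EnvConst a))
| EnvMul0 s : env_eq (EnvMul (EnvConst 0) s) (EnvConst 0)
| EnvGenD x y : env_eq (EnvGen (x + y)) (EnvAdd (EnvGen x) (EnvGen y))
| EnvGenZ a x : env_eq (EnvGen (a *: x)) (EnvMul (EnvConst a) (EnvGen x))
| EnvBracket x y :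
    env_eq (EnvMul (EnvGen x) (EnvGen y))
           (EnvAdd (EnvMul (EnvGen y) (EnvGen x)) (EnvGen (lie_bracket x y))).

Fixpoint env_eval (K : fieldType) (g : lieAlgType K) (A : pzRingType)
    (c : K -> A) (phi : g -> A) (t : env_term g) : A :=
  match t with
  | EnvGen x => phi x
  | EnvConst a => c a
  | EnvAdd s t => env_eval c phi s + env_eval c phi t
  | EnvMul s t => env_eval c phi s * env_eval c phi t
  end.

(* c makes the ring A a K-algebra, and phi : g -> A is a Lie homomorphism. *)
Record env_hom (K : fieldType) (g : lieAlgType K) (A : pzRingType)
    (c : K -> A) (phi : g -> A) : Prop := EnvHom {
  env_hom1 : c 1 = 1;
  env_homD : {morph c : a b / a + b};
  env_homM : {morph c : a b / a * b};
  env_homC : forall a x, c a * x = x * c a;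
  env_hom_genD : {morph phi : x y / x + y};
  env_hom_genZ : forall a x, phi (a *: x) = c a * phi x;
  env_hom_bracket : forall x y,
    phi (lie_bracket x y) = phi x * phi y - phi y * phi x }.

Section EnvelopingAlgebra.
Variables (K : fieldType) (g : lieAlgType K).

HB.instance Definition _ := gen_eqMixin (env_term g).
HB.instance Definition _ := gen_choiceMixin (env_term g).

Let eqt (s t : env_term g) : bool := `[< env_eq s t >].
Let eqt_refl : reflexive eqt.
Proof. by move=> s; apply/asboolP/EnvRefl. Qed.
Let eqt_sym : ssrbool.symmetric eqt.
Proof. by move=> s t; apply/asboolP/asboolP; apply: EnvSym. Qed.
Let eqt_trans : transitive eqt.
Proof.
by move=> t s u /asboolP st /asboolP tu; apply/asboolP/(EnvTrans st tu).
Qed.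

Definition env_rel := EquivRel eqt eqt_refl eqt_sym eqt_trans.
Definition env : Type := {eq_quot env_rel}.
HB.instance Definition _ := Choice.on env.
HB.instance Definition _ := EqQuotient.on env.

Lemma env_piP s t : reflect (env_eq s t) (\pi_env s == \pi_env t).
Proof. by rewrite eqmodE /=; apply: asboolP. Qed.

Lemma env_piE s t : env_eq s t -> \pi_env s = \pi_env t.
Proof. by move=> st; apply/eqP/env_piP. Qed.

Lemma env_repr s : env_eq (repr (\pi_env s)) s.
Proof. by apply/env_piP; rewrite reprK. Qed.

Definition env_const (a : K) : env := \pi_env (EnvConst a).
Definition env_add (u v : env) : env := \pi_env (EnvAdd (repr u) (repr v)).
Definition env_mul (u v : env) : env := \pi_env (EnvMul (repr u) (repr v)).

Let addE s t : env_add (\pi_env s) (\pi_env t) = \pi_env (EnvAdd s t).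
Proof. by apply/env_piE/EnvAddCongr; apply: env_repr. Qed.
Let mulE s t : env_mul (\pi_env s) (\pi_env t) = \pi_env (EnvMul s t).
Proof. by apply/env_piE/EnvMulCongr; apply: env_repr. Qed.

Let addA : associative env_add.
Proof.
move=> u v w; elim/quotW: u => u; elim/quotW: v => v; elim/quotW: w => w.
by rewrite (addE v) (addE u v) !addE; apply/env_piE/EnvAddA.
Qed.
Let addC : commutative env_add.
Proof.
move=> u v; elim/quotW: u => u; elim/quotW: v => v.
by rewrite !addE; apply/env_piE/EnvAddC.
Qed.
Let add0 : left_id (env_const 0) env_add.
Proof.
by move=> u; elim/quotW: u => u; rewrite addE; apply/env_piE/EnvAdd0.
Qed.
Let mulA : associative env_mul.
Proof.
move=> u v w; elim/quotW: u => u; elim/quotW: v => v; elim/quotW: w => w.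
by rewrite (mulE v) (mulE u v) !mulE; apply/env_piE/EnvMulA.
Qed.
Let mul1 : left_id (env_const 1) env_mul.
Proof.
by move=> u; elim/quotW: u => u; rewrite mulE; apply/env_piE/EnvMul1.
Qed.
Let constC a u : env_mul (env_const a) u = env_mul u (env_const a).
Proof.
by elim/quotW: u => u; rewrite !mulE; apply/env_piE/EnvConstC.
Qed.
Let mulr1 : right_id (env_const 1) env_mul.
Proof. by move=> u; rewrite -constC mul1. Qed.
Let mulDl : left_distributive env_mul env_add.
Proof.
move=> u v w; elim/quotW: u => u; elim/quotW: v => v; elim/quotW: w => w.
by rewrite (addE u) (mulE u) (mulE v) mulE addE; apply/env_piE/EnvMulDl.
Qed.
Let mulDr : right_distributive env_mul env_add.
Proof.
move=> u v w; elim/quotW: u => u; elim/quotW: v => v; elim/quotW: w => w.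
by rewrite (addE v) (mulE u v) (mulE u w) mulE addE; apply/env_piE/EnvMulDr.
Qed.
Let constD a b : env_const (a + b) = env_add (env_const a) (env_const b).
Proof. by rewrite addE; apply/env_piE/EnvConstD. Qed.
Let constM a b : env_const (a * b) = env_mul (env_const a) (env_const b).
Proof. by rewrite mulE; apply/env_piE/EnvConstM. Qed.
Let const0 u : env_mul (env_const 0) u = env_const 0.
Proof. by elim/quotW: u => u; rewrite mulE; apply/env_piE/EnvMul0. Qed.
Let addN : left_inverse (env_const 0) (env_mul (env_const (-1))) env_add.
Proof.
by move=> u; rewrite -{2}[u]mul1 -mulDl -constD addNr const0.
Qed.

HB.instance Definition _ := GRing.isZmodule.Build env addA addC add0 addN.
HB.instance Definition _ :=
  GRing.Zmodule_isPzRing.Build env mulA mul1 mulr1 mulDl mulDr.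

Lemma env_eval_eq (A : pzRingType) (c : K -> A) (phi : g -> A) s t :
  env_hom c phi -> env_eq s t -> env_eval c phi s = env_eval c phi t.
Proof.
case=> c1 cD cM cC phiD phiZ phiB.
have c0 : c 0 = 0 by apply: (addIr (c 0)); rewrite -cD !add0r.
elim=> {s t} /=.
- by [].
- by [].
- by move=> s t u _ -> _ ->.
- by move=> s s' t t' _ -> _ ->.
- by move=> s s' t t' _ -> _ ->.
- by move=> s t u; rewrite addrA.
- by move=> s t; rewrite addrC.
- by move=> s; rewrite c0 add0r.
- by move=> s t u; rewrite mulrA.
- by move=> s; rewrite c1 mul1r.
- by move=> s t u; rewrite mulrDl.
- by move=> s t u; rewrite mulrDr.
- exact: cD.
- exact: cM.
- by move=> a s; apply: cC.
- by move=> s; rewrite c0 mul0r.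
- exact: phiD.
- exact: phiZ.
- by move=> x y; rewrite phiB addrC subrK.
Qed.

Let env_nonzero : 1 != 0 :> env.
Proof.
apply/eqP=> /eqP/env_piP/(@env_eval_eq K idfun (fun=> 0)) /= E.
suff /eqP : 1 = 0 :> K by rewrite oner_eq0.
by apply: E; split=> // [a x|x y|a x|x y] /=;
  rewrite ?addr0 ?mulr0 ?subr0 // mulrC.
Qed.

HB.instance Definition _ := GRing.PzSemiRing_isNonZero.Build env env_nonzero.

Definition env_scale (a : K) (u : env) : env := env_const a * u.

Let scaleA a b u : env_scale a (env_scale b u) = env_scale (a * b) u.
Proof. by rewrite /env_scale constM mulrA. Qed.
Let scale1 : left_id 1 env_scale.
Proof. exact: mul1r. Qed.
Let scaleDr : right_distributive env_scale +%R.
Proof. by move=> a u v; apply: mulrDr. Qed.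
Let scaleDl u : {morph env_scale^~ u : a b / a + b}.
Proof. by move=> a b; rewrite /env_scale constD mulrDl. Qed.

HB.instance Definition _ :=
  GRing.Zmodule_isLmodule.Build K env scaleA scale1 scaleDr scaleDl.

Let scaleAl (a : K) (u v : env) : a *: (u * v) = (a *: u) * v.
Proof. by rewrite /GRing.scale /= /env_scale mulrA. Qed.
HB.instance Definition _ := GRing.Lmodule_isLalgebra.Build K env scaleAl.

Let scaleAr (a : K) (u v : env) : a *: (u * v) = u * (a *: v).
Proof.
rewrite /GRing.scale /= /env_scale !mulrA; congr (_ * _); exact: constC.
Qed.
HB.instance Definition _ := GRing.Lalgebra_isAlgebra.Build K env scaleAr.

Definition env_gen (x : g) : env := \pi_env (EnvGen x).

Lemma env_gen_linear : linear env_gen.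
Proof.
move=> a x y; rewrite [RHS](_ : _ = env_add (env_mul (env_const a) (env_gen x))
  (env_gen y)) // mulE addE; apply: env_piE.
apply: EnvTrans (EnvGenD _ _) (EnvAddCongr _ (EnvRefl _)); exact: EnvGenZ.
Qed.

Lemma env_gen_bracket x y :
  env_gen (lie_bracket x y) = env_gen x * env_gen y - env_gen y * env_gen x.
Proof.
apply/eqP; rewrite eq_sym subr_eq addrC; apply/eqP.
rewrite [LHS]mulE [env_gen y * _]mulE [RHS]addE.
exact/env_piE/EnvBracket.
Qed.

Lemma env_ind (P : env -> Prop) :
  P 1 -> (forall x, P (env_gen x)) ->
  (forall a u v, P u -> P v -> P (a *: u + v)) ->
  (forall u v, P u -> P v -> P (u * v)) -> forall u, P u.
Proof.
move=> P1 Pg PL PM u; elim/quotW: u.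
have PZ a u : P u -> P (a *: u).
  move=> Pu; rewrite -[_ *: _]addr0 -[0](addNr 1) -scaleN1r.
  by do 2!apply: (PL) => //.
elim=> [x|a|s Ps t Pt|s Ps t Pt].
- exact: Pg.
- by have := PZ a _ P1; rewrite [_ *: _](mulr1 (env_const a)).
- by have := PL 1 _ _ Ps Pt; rewrite scale1r [_ + _]addE.
- by have := PM _ _ Ps Pt; rewrite [_ * _]mulE.
Qed.

(* The extension of phi to an algebra morphism U(g) -> A; it does not depend on
   the chosen representative when env_hom c phi holds: see [env_lift_pi]. *)
Definition env_lift (A : pzRingType) (c : K -> A) (phi : g -> A) (u : env) : A :=
  env_eval c phi (repr u).

Section Lift.
Variables (A : pzRingType) (c : K -> A) (phi : g -> A).
Hypothesis h : env_hom c phi.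

Lemma env_lift_pi s : env_lift c phi (\pi_env s) = env_eval c phi s.
Proof. exact/env_eval_eq/env_repr. Qed.

Lemma env_lift_gen x : env_lift c phi (env_gen x) = phi x.
Proof. exact: env_lift_pi. Qed.

Lemma env_lift1 : env_lift c phi 1 = 1.
Proof. by rewrite [LHS]env_lift_pi /= (env_hom1 h). Qed.

Lemma env_liftD : {morph env_lift c phi : u v / u + v}.
Proof.
move=> u v; elim/quotW: u => u; elim/quotW: v => v.
by rewrite [_ + _ in LHS]addE !env_lift_pi.
Qed.

Lemma env_liftM : {morph env_lift c phi : u v / u * v}.
Proof.
move=> u v; elim/quotW: u => u; elim/quotW: v => v.
by rewrite [_ * _ in LHS]mulE !env_lift_pi.
Qed.

Lemma env_liftZ a u : env_lift c phi (a *: u) = c a * env_lift c phi u.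
Proof. by rewrite [LHS]env_liftM env_lift_pi. Qed.

End Lift.
End EnvelopingAlgebra.

Record hopf_data (K : fieldType) := HopfData {
  hopf_alg :> algType K;
  comul : hopf_alg -> hopf_alg ⊗ hopf_alg;
  counit : hopf_alg -> K;
  antipode : hopf_alg -> hopf_alg }.

Arguments comul {K h} _.
Arguments counit {K h} _.
Arguments antipode {K h} _.

Record hopf_algebra (K : fieldType) (H : hopf_data K) : Prop := HopfAlgebra {
  comul_linear : linear (@comul K H);
  counit_scalar : scalar (@counit K H);
  antipode_linear : linear (@antipode K H);
  comul_coassoc : forall h : H,
    \Sw_(a, b <- comul h) comul a ⊗ b =
    \Sw_(a, b <- comul h) \Sw_(c, d <- comul b) a ⊗ c ⊗ d;
  counitl : forall h : H, \Sw_(a, b <- comul h) counit a *: b = h;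
  counitr : forall h : H, \Sw_(a, b <- comul h) counit b *: a = h;
  comul1 : comul (1 : H) = 1;
  comulM : forall h k : H, comul (h * k) = comul h * comul k;
  counit1 : counit (1 : H) = 1;
  counitM : forall h k : H, counit (h * k) = counit h * counit k;
  antipodel : forall h : H,
    \Sw_(a, b <- comul h) antipode a * b = counit h *: 1;
  antipoder : forall h : H,
    \Sw_(a, b <- comul h) a * antipode b = counit h *: 1 }.

Section HopfMatchedPair.
Variables (K : fieldType) (U F : hopf_data K).
Variables (act : U -> F -> F) (co : U -> U ⊗ F).

Record left_action : Prop := LeftAction {
  act_bilinear : bilinear_map act;
  act1 : forall f, act 1 f = f;
  actM : forall u v f, act (u * v) f = act u (act v f) }.

Record left_module_algebra : Prop := LeftModuleAlgebra {
  modalg_action : left_action;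
  modalgM : forall u f g,
    act u (f * g) = \Sw_(u1, u2 <- comul u) act u1 f * act u2 g;
  modalg1 : forall u, act u 1 = counit u *: 1 }.

Record right_coaction : Prop := RightCoaction {
  coact_linear : linear co;
  coactA : forall u, \Sw_(a, f <- co u) co a ⊗ f =
    \Sw_(a, f <- co u) \Sw_(f1, f2 <- comul f) a ⊗ f1 ⊗ f2;
  coact_counit : forall u, \Sw_(a, f <- co u) counit f *: a = u }.

Record right_comodule_coalgebra : Prop := RightComoduleCoalgebra {
  comodcoalg_coaction : right_coaction;
  comodcoalg_comul : forall u,
    \Sw_(a, f <- co u) \Sw_(a1, a2 <- comul a) a1 ⊗ a2 ⊗ f =
    \Sw_(u1, u2 <- comul u) \Sw_(a, f <- co u1) \Sw_(b, g <- co u2)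
      a ⊗ b ⊗ (f * g);
  comodcoalg_counit : forall u,
    \Sw_(a, f <- co u) counit a *: f = counit u *: 1 }.

Definition coact_multiplicative : Prop := forall u v,
  co (u * v) = \Sw_(u1, u2 <- comul u) \Sw_(a, f <- co u1) \Sw_(b, g <- co v)
                 (a * b) ⊗ (f * act u2 g).

Record hopf_matched_pair : Prop := HopfMatchedPair {
  hmp_hopfU : hopf_algebra U;
  hmp_hopfF : hopf_algebra F;
  hmp_modalg : left_module_algebra;
  hmp_comodcoalg : right_comodule_coalgebra;
  hmp_counit : forall u f, counit (act u f) = counit u * counit f;
  hmp_comul : forall u f, comul (act u f) =
    \Sw_(u1, u2 <- comul u) \Sw_(a, g <- co u1) \Sw_(f1, f2 <- comul f)
      act a f1 ⊗ (g * act u2 f2);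
  hmp_coact1 : co 1 = 1 ⊗ 1;
  hmp_coactM : coact_multiplicative;
  hmp_compat : forall u f,
    \Sw_(u1, u2 <- comul u) \Sw_(a, g <- co u2) a ⊗ (act u1 f * g) =
    \Sw_(u1, u2 <- comul u) \Sw_(a, g <- co u1) a ⊗ (g * act u2 f) }.

End HopfMatchedPair.

(* The Hopf structure of U(g): the elements of g are primitive. *)
Section EnvelopingHopf.
Variables (K : fieldType) (g : lieAlgType K).

Definition env_comul : env g -> env g ⊗ env g :=
  env_lift (A := tensor (env g) (env g)) (fun a => a *: (1 ⊗ 1))
    (fun x => env_gen x ⊗ 1 + 1 ⊗ env_gen x).

Definition env_counit : env g -> K := env_lift idfun (fun=> 0).

(* The values are taken in the converse ring: S is an antimorphism. *)
Definition env_antipode : env g -> env g :=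
  env_lift (A := (env g)^c) (fun a => a *: (1 : env g)) (fun x => - env_gen x).

Let gen_D x y : env_gen (x + y) = env_gen x + env_gen y :> env g.
Proof. by have := env_gen_linear 1 x y; rewrite !scale1r. Qed.

Let gen_Z a x : env_gen (a *: x) = a *: env_gen x :> env g.
Proof.
have g0 : env_gen 0 = 0 :> env g.
  by apply: (addIr (env_gen 0)); rewrite -gen_D !add0r.
by have := env_gen_linear a x 0; rewrite g0 !addr0.
Qed.

Lemma env_comul_hom : env_hom (A := tensor (env g) (env g))
  (fun a => a *: (1 ⊗ 1))
  (fun x : g => env_gen x ⊗ 1 + 1 ⊗ env_gen x).
Proof.
split=> [|a b|a b|a x|x y|a x|x y]; rewrite -?tens1E.
- by rewrite scale1r.
- by rewrite scalerDl.
- by rewrite -tensor_scaleAl mul1r scalerA.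
- by rewrite -tensor_scaleAl -tensor_scaleAr mul1r mulr1.
- by rewrite gen_D tens_addl tens_addr addrACA.
- by rewrite gen_Z tens_scalel tens_scaler -tensor_scaleAl mul1r scalerDr.
have B (u v : env g) w : (u - v) ⊗ w = u ⊗ w - v ⊗ w :> tensor _ (env g).
  by rewrite -scaleN1r tens_addl tens_scalel scaleN1r.
have B' (u v : env g) w : w ⊗ (u - v) = w ⊗ u - w ⊗ v :> tensor (env g) _.
  by rewrite -scaleN1r tens_addr tens_scaler scaleN1r.
rewrite env_gen_bracket !mulrDl !mulrDr !tensM !(mul1r, mulr1) B B'.
rewrite [X in _ = _ - X]addrACA [in RHS]opprD [RHS]addrACA.
by congr (_ + _); rewrite opprD addrACA subrr ?addr0 ?add0r.
Qed.

Lemma env_counit_hom : env_hom (A := K) idfun (fun _ : g => 0).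
Proof.
by split=> // [a x|x y|a x|x y] /=;
  rewrite ?addr0 ?mulr0 ?subr0 // mulrC.
Qed.

Lemma env_antipode_hom : env_hom (A := (env g)^c)
  (fun a => a *: (1 : env g)) (fun x : g => - env_gen x).
Proof.
split=> [|a b|a b|a x|x y|a x|x y].
- exact: scale1r.
- exact: scalerDl.
- rewrite [RHS](_ : _ = (b *: (1 : env g)) * (a *: 1)) //.
  by rewrite -scalerAl mul1r scalerA mulrC.
- rewrite [LHS](_ : _ = (x : env g) * (a *: 1)) //.
  rewrite [RHS](_ : _ = (a *: (1 : env g)) * x) //.
  by rewrite -scalerAl -scalerAr mul1r mulr1.
- by rewrite gen_D [LHS]opprD.
- rewrite gen_Z [RHS](_ : _ = - env_gen x * (a *: (1 : env g))) //.
  by rewrite -scalerAr mulr1 scalerN.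
- rewrite env_gen_bracket [RHS](_ : _ = - env_gen y * - env_gen x -
    - env_gen x * - env_gen y :> env g) //.
  by rewrite !mulrNN opprB.
Qed.

Definition env_hopf : hopf_data K :=
  HopfData env_comul env_counit env_antipode.

End EnvelopingHopf.

(* f is the restriction of a polynomial, T being embedded in K^n by x. *)
Definition polynomial_fun (K : fieldType) (n : nat) (T : Type)
    (x : T -> 'I_n -> K) (f : T -> K) : Prop :=
  exists p : {mpoly K[n]}, forall t, f t = p.@[x t].

(* The embedding of S × T in K^(m + n). *)
Definition pair_coord (K : fieldType) (m n : nat) (S T : Type)
    (x : S -> 'I_m -> K) (y : T -> 'I_n -> K) (st : S * T) (i : 'I_(m + n)) : K :=
  match fintype.split i with inl j => x st.1 j | inr j => y st.2 j end.

(* An abstract group identified by acoord with the locus in K^adim of the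
   equations aeqs. *)
Record affine_group (K : fieldType) := AffineGroup {
  agroup :> groupType;
  adim : nat;
  acoord : agroup -> 'I_adim -> K;
  aeqs : set {mpoly K[adim]};
  acoord_inj : injective acoord;
  acoord_locus : forall v : 'I_adim -> K,
    (exists x, acoord x = v) <-> (forall p, aeqs p -> p.@[v] = 0);
  amul_poly : forall i, polynomial_fun (pair_coord acoord acoord)
    (fun xy => acoord (xy.1 * xy.2)%g i);
  ainv_poly : forall i, polynomial_fun acoord (fun x => acoord (x^-1)%g i) }.

Definition zariski_closed (K : fieldType) (G : affine_group K) (Z : set G) :=
  exists E : set {mpoly K[adim G]},
    forall x, Z x <-> (forall p, E p -> p.@[acoord x] = 0).

Definition zariski_connected (K : fieldType) (G : affine_group K) : Prop :=
  forall Z : set G, zariski_closed Z -> zariski_closed (~` Z)%classic ->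
    Z = set0 \/ Z = setT.

Lemma polynomial_comp (K : fieldType) (n : nat) (T : Type)
    (x : T -> 'I_n -> K) (m : nat) (h : T -> 'I_m -> K) (p : {mpoly K[m]}) :
  (forall i, polynomial_fun x (h^~ i)) -> polynomial_fun x (fun t => p.@[h t]).
Proof.
move=> /choice[q qE]; exists (p \mPo [tuple q i | i < m]) => t.
by rewrite comp_mpoly_meval; apply: meval_eq => i; rewrite tnth_mktuple qE.
Qed.

Record polyfun (K : fieldType) (G : affine_group K) := PolyFun {
  polyfun_val :> G -> K;
  polyfunP : polynomial_fun (@acoord K G) polyfun_val }.

Notation "''P' ( G )" := (polyfun G) (at level 8, format "''P' ( G )").

Section PolyFunAlgebra.
Variables (K : fieldType) (G : affine_group K).
Implicit Types (f g h : 'P(G)).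

Lemma polyfun_ext f g : (forall x, f x = g x) -> f = g.
Proof.
case: f g => [f fP] [g gP] /= /funext fg; rewrite fg in fP *.
by congr PolyFun; apply: Prop_irrelevance.
Qed.

HB.instance Definition _ := gen_eqMixin 'P(G).
HB.instance Definition _ := gen_choiceMixin 'P(G).

Lemma polyfun_comp (T : Type) n (x : T -> 'I_n -> K) (phi : T -> G) f :
  (forall i, polynomial_fun x (fun t => acoord (phi t) i)) ->
  polynomial_fun x (f \o phi).
Proof.
case: f => f [p fE] hphi; have [q qE] := polynomial_comp p hphi.
by exists q => t; rewrite -qE -fE.
Qed.

Let constP a : polynomial_fun (@acoord K G) (fun=> a).
Proof. by exists a%:MP => x; rewrite mevalC. Qed.
Let addP f g : polynomial_fun (@acoord K G) (fun x => f x + g x).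
Proof.
by case: f g => [f [p fE]] [g [q gE]]; exists (p + q) => x;
  rewrite /= mevalD fE gE.
Qed.
Let mulP f g : polynomial_fun (@acoord K G) (fun x => f x * g x).
Proof.
by case: f g => [f [p fE]] [g [q gE]]; exists (p * q) => x;
  rewrite /= mevalM fE gE.
Qed.
Let oppP f : polynomial_fun (@acoord K G) (fun x => - f x).
Proof. by case: f => [f [p fE]]; exists (- p) => x; rewrite /= mevalN fE. Qed.
Let scaleP a f : polynomial_fun (@acoord K G) (fun x => a * f x).
Proof. by case: f => [f [p fE]]; exists (a *: p) => x; rewrite /= mevalZ fE. Qed.

Definition polyfun_const a : 'P(G) := PolyFun (constP a).
Definition polyfun_add f g : 'P(G) := PolyFun (addP f g).
Definition polyfun_mul f g : 'P(G) := PolyFun (mulP f g).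
Definition polyfun_opp f : 'P(G) := PolyFun (oppP f).
Definition polyfun_scale a f : 'P(G) := PolyFun (scaleP a f).

Let addA : associative polyfun_add.
Proof. by move=> f g h; apply: polyfun_ext => x /=; rewrite addrA. Qed.
Let addC : commutative polyfun_add.
Proof. by move=> f g; apply: polyfun_ext => x /=; rewrite addrC. Qed.
Let add0 : left_id (polyfun_const 0) polyfun_add.
Proof. by move=> f; apply: polyfun_ext => x /=; rewrite add0r. Qed.
Let addN : left_inverse (polyfun_const 0) polyfun_opp polyfun_add.
Proof. by move=> f; apply: polyfun_ext => x /=; rewrite addNr. Qed.
HB.instance Definition _ := GRing.isZmodule.Build 'P(G) addA addC add0 addN.

Let mulA : associative polyfun_mul.
Proof. by move=> f g h; apply: polyfun_ext => x /=; rewrite mulrA. Qed.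
Let mulC : commutative polyfun_mul.
Proof. by move=> f g; apply: polyfun_ext => x /=; rewrite mulrC. Qed.
Let mul1 : left_id (polyfun_const 1) polyfun_mul.
Proof. by move=> f; apply: polyfun_ext => x /=; rewrite mul1r. Qed.
Let mulDl : left_distributive polyfun_mul polyfun_add.
Proof. by move=> f g h; apply: polyfun_ext => x /=; rewrite mulrDl. Qed.
Let nonzero : polyfun_const 1 != 0.
Proof.
apply/eqP=> /(congr1 (fun f : 'P(G) => f 1%g)) /eqP.
by rewrite oner_eq0.
Qed.
HB.instance Definition _ :=
  GRing.Zmodule_isComNzRing.Build 'P(G) mulA mulC mul1 mulDl nonzero.

Let scaleA a b f : polyfun_scale a (polyfun_scale b f) = polyfun_scale (a * b) f.
Proof. by apply: polyfun_ext => x /=; rewrite mulrA. Qed.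
Let scale1 : left_id 1 polyfun_scale.
Proof. by move=> f; apply: polyfun_ext => x /=; rewrite mul1r. Qed.
Let scaleDr : right_distributive polyfun_scale +%R.
Proof. by move=> a f g; apply: polyfun_ext => x /=; rewrite mulrDr. Qed.
Let scaleDl f : {morph polyfun_scale^~ f : a b / a + b}.
Proof. by move=> a b; apply: polyfun_ext => x /=; rewrite mulrDl. Qed.
HB.instance Definition _ :=
  GRing.Zmodule_isLmodule.Build K 'P(G) scaleA scale1 scaleDr scaleDl.

Let scaleAl (a : K) f g : a *: (f * g) = (a *: f) * g.
Proof. by apply: polyfun_ext => x /=; rewrite mulrA. Qed.
HB.instance Definition _ := GRing.Lmodule_isLalgebra.Build K 'P(G) scaleAl.
HB.instance Definition _ := GRing.Lalgebra_isComAlgebra.Build K 'P(G).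

Lemma polyfunD f g x : (f + g) x = f x + g x. Proof. by []. Qed.
Lemma polyfunM f g x : (f * g) x = f x * g x. Proof. by []. Qed.
Lemma polyfunZ a f x : (a *: f) x = a * f x. Proof. by []. Qed.
Lemma polyfun0 x : (0 : 'P(G)) x = 0. Proof. by []. Qed.
Lemma polyfun1 x : (1 : 'P(G)) x = 1. Proof. by []. Qed.

Lemma polyfun_sum I (r : seq I) (F : I -> 'P(G)) x :
  (\sum_(i <- r) F i) x = \sum_(i <- r) F i x.
Proof. by elim/big_rec2: _ => // i y z _ <-. Qed.

Lemma polyfun_prod I (r : seq I) (F : I -> 'P(G)) x :
  (\prod_(i <- r) F i) x = \prod_(i <- r) F i x.
Proof. by elim/big_rec2: _ => // i y z _ <-. Qed.

Lemma polyfunX f n x : (f ^+ n) x = f x ^+ n.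
Proof. by elim: n => // n IH; rewrite !exprS polyfunM IH. Qed.

End PolyFunAlgebra.

Section TwoVariables.
Variables (K : fieldType) (G H : affine_group K).

Definition teval (t : 'P(G) ⊗ 'P(H)) (x : G) (y : H) : K :=
  \Sw_(f, g <- t) f x * g y.

(* The tensor in P(G) ⊗ P(H) whose value at (x, y) is F x y for all x, y; it
   exists when F is polynomial on G × H: see [tensor_ofP]. *)
Definition tensor_of (F : G -> H -> K) : 'P(G) ⊗ 'P(H) :=
  xget 0 [set t | forall x y, teval t x y = F x y].

Let teval_bilin x y : bilinear_map (M := K^o)
  (fun (f : 'P(G)) (g : 'P(H)) => f x * g y).
Proof.
split=> a f g h; rewrite polyfunD polyfunZ.
  by rewrite mulrDl -mulrA.
by rewrite mulrDr mulrCA.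
Qed.

Lemma teval_tens f g x y : teval (f ⊗ g) x y = f x * g y.
Proof. exact: (sweedler_tens (teval_bilin x y)). Qed.

Lemma tevalD s t x y : teval (s + t) x y = teval s x y + teval t x y.
Proof. exact: (sweedlerD (teval_bilin x y)). Qed.

Lemma tevalZ a t x y : teval (a *: t) x y = a * teval t x y.
Proof. exact: (sweedlerZ (teval_bilin x y)). Qed.

Lemma teval0 x y : teval 0 x y = 0.
Proof. by rewrite -[0](scale0r 0) tevalZ mul0r. Qed.

Lemma tensor_ofP (F : G -> H -> K) :
  polynomial_fun (pair_coord (@acoord K G) (@acoord K H))
    (fun xy => F xy.1 xy.2) ->
  forall x y, teval (tensor_of F) x y = F x y.
Proof.
move=> [p pE]; rewrite /tensor_of.
set P := (X in xget _ X); suff : exists t, P t by move/(xgetPex 0).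
have cP (L : affine_group K) i : polynomial_fun (@acoord K L) (@acoord K L ^~ i).
  by exists 'X_i => x; rewrite mevalXU.
pose c (L : affine_group K) i := PolyFun (cP L i).
exists (\sum_(m <- msupp p) p@_m *:
  ((\prod_i c G i ^+ m (lshift _ i)) ⊗ (\prod_i c H i ^+ m (rshift _ i)))).
move=> x y; rewrite -[F x y]/(F (x, y).1 (x, y).2) pE mevalE.
rewrite (big_morph (fun t => teval t x y) (fun s t => tevalD s t x y) (teval0 x y)).
apply: eq_bigr => m _; rewrite tevalZ teval_tens !polyfun_prod big_split_ord /=.
congr (_ * (_ * _)); apply: eq_bigr => i _; rewrite polyfunX /pair_coord /=.
  by rewrite (unsplitK (inl i)).
by rewrite (unsplitK (inr i)).
Qed.

End TwoVariables.

Section PolyFunHopf.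
Variables (K : fieldType) (G : affine_group K).

Definition polyfun_comul (f : 'P(G)) : 'P(G) ⊗ 'P(G) :=
  tensor_of (fun x y => f (x * y)%g).

Definition polyfun_counit (f : 'P(G)) : K := f 1%g.

Definition polyfun_antipode (f : 'P(G)) : 'P(G) :=
  PolyFun (polyfun_comp f (@ainv_poly K G)).

Definition polyfun_hopf : hopf_data K :=
  HopfData polyfun_comul polyfun_counit polyfun_antipode.

Lemma polyfun_comulE f x y : teval (polyfun_comul f) x y = f (x * y)%g.
Proof.
rewrite tensor_ofP //.
exact: (@polyfun_comp _ _ _ _ _ (fun xy : G * G => xy.1 * xy.2)%g f
  (@amul_poly K G)).
Qed.

End PolyFunHopf.

Record point_der (K : fieldType) (G : affine_group K) := PointDer {
  point_der_val :> 'P(G) -> K;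
  point_der_linear : forall a f g,
    point_der_val (a *: f + g) = a * point_der_val f + point_der_val g;
  point_derM : forall f g,
    point_der_val (f * g) = f 1%g * point_der_val g + point_der_val f * g 1%g }.

Section LieAlgebraOfGroup.
Variables (K : fieldType) (G : affine_group K).
Implicit Types (X Y Z : point_der G) (f : 'P(G)).

Lemma point_der_ext X Y : (forall f, X f = Y f) -> X = Y.
Proof.
case: X Y => [X XL XM] [Y YL YM] /= /funext XY; rewrite XY in XL XM *.
by congr PointDer; apply: Prop_irrelevance.
Qed.

Lemma pderD X f g : X (f + g) = X f + X g.
Proof. by have := point_der_linear X 1 f g; rewrite scale1r mul1r. Qed.

Lemma pder0 X : X 0 = 0.
Proof. by apply: (addIr (X 0)); rewrite -pderD !add0r. Qed.

Lemma pderZ X a f : X (a *: f) = a * X f.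
Proof. by have := point_der_linear X a f 0; rewrite pder0 !addr0. Qed.

HB.instance Definition _ := gen_eqMixin (point_der G).
HB.instance Definition _ := gen_choiceMixin (point_der G).

Let zeroL a f g : (fun _ : 'P(G) => 0 : K) (a *: f + g) = a * 0 + 0.
Proof. by rewrite mulr0 addr0. Qed.
Let zeroM (f g : 'P(G)) : 0 = f 1%g * 0 + 0 * g 1%g :> K.
Proof. by rewrite mulr0 mul0r addr0. Qed.
Definition point_der_zero : point_der G :=
  @PointDer _ _ (fun=> 0) zeroL zeroM.

Let addL X Y a f g : X (a *: f + g) + Y (a *: f + g) =
  a * (X f + Y f) + (X g + Y g).
Proof. by rewrite !pderD !pderZ; ring. Qed.
Let addM X Y f g : X (f * g) + Y (f * g) =
  f 1%g * (X g + Y g) + (X f + Y f) * g 1%g.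
Proof. by rewrite !point_derM; ring. Qed.
Definition point_der_add X Y : point_der G :=
  @PointDer _ _ (fun f => X f + Y f) (addL X Y) (addM X Y).

Let scaleL b X a f g : b * X (a *: f + g) = a * (b * X f) + b * X g.
Proof. by rewrite pderD pderZ; ring. Qed.
Let scaleM b X f g :
  b * X (f * g) = f 1%g * (b * X g) + (b * X f) * g 1%g.
Proof. by rewrite point_derM; ring. Qed.
Definition point_der_scale b X : point_der G :=
  @PointDer _ _ (fun f => b * X f) (scaleL b X) (scaleM b X).

Let pder_addA : associative point_der_add.
Proof. by move=> X Y Z; apply: point_der_ext => f /=; rewrite addrA. Qed.
Let pder_addC : commutative point_der_add.
Proof. by move=> X Y; apply: point_der_ext => f /=; rewrite addrC. Qed.
Let pder_add0 : left_id point_der_zero point_der_add.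
Proof. by move=> X; apply: point_der_ext => f /=; rewrite add0r. Qed.
Let pder_addN :
  left_inverse point_der_zero (point_der_scale (-1)) point_der_add.
Proof.
by move=> X; apply: point_der_ext => f /=; rewrite mulN1r addNr.
Qed.
HB.instance Definition _ := GRing.isZmodule.Build (point_der G)
  pder_addA pder_addC pder_add0 pder_addN.

Let pder_scaleA a b X :
  point_der_scale a (point_der_scale b X) = point_der_scale (a * b) X.
Proof. by apply: point_der_ext => f /=; rewrite mulrA. Qed.
Let pder_scale1 : left_id 1 point_der_scale.
Proof. by move=> X; apply: point_der_ext => f /=; rewrite mul1r. Qed.
Let pder_scaleDr : right_distributive point_der_scale +%R.
Proof. by move=> a X Y; apply: point_der_ext => f /=; rewrite mulrDr. Qed.
Let pder_scaleDl X : {morph point_der_scale^~ X : a b / a + b}.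
Proof. by move=> a b; apply: point_der_ext => f /=; rewrite mulrDl. Qed.
HB.instance Definition _ := GRing.Zmodule_isLmodule.Build K (point_der G)
  pder_scaleA pder_scale1 pder_scaleDr pder_scaleDl.

Lemma point_derDE X Y f : (X + Y) f = X f + Y f. Proof. by []. Qed.
Lemma point_derZE a X f : (a *: X) f = a * X f. Proof. by []. Qed.
Lemma point_derBE X Y f : (X - Y) f = X f - Y f.
Proof. by rewrite -scaleN1r point_derDE point_derZE mulN1r. Qed.

(* The convolution product (phi ⊗ psi) o Δ, which computes the composition of
   left invariant derivations; its commutator is the Lie bracket of G. *)
Definition convol (phi psi : 'P(G) -> K) (f : 'P(G)) : K :=
  \Sw_(a, b <- polyfun_comul f) phi a * psi b.

Definition ltrans (x : G) (f : 'P(G)) : 'P(G) :=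
  \Sw_(a, b <- polyfun_comul f) a x *: b.
Definition rconv (Y : point_der G) (f : 'P(G)) : 'P(G) :=
  \Sw_(a, b <- polyfun_comul f) Y b *: a.

Let pder_sum X I (r : seq I) (F : I -> 'P(G)) :
  X (\sum_(i <- r) F i) = \sum_(i <- r) X (F i).
Proof. exact: (big_morph X (pderD X) (pder0 X)). Qed.

Lemma ltransE x f y : ltrans x f y = f (x * y)%g.
Proof. by rewrite /ltrans /sweedler polyfun_sum -polyfun_comulE. Qed.

Lemma rconvE Y f x : rconv Y f x = Y (ltrans x f).
Proof.
rewrite /rconv /ltrans /sweedler polyfun_sum pder_sum.
by apply: eq_bigr => p _; rewrite pderZ polyfunZ mulrC.
Qed.

Lemma convolE X Y f : convol X Y f = X (rconv Y f).
Proof.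
rewrite /convol /rconv /sweedler pder_sum.
by apply: eq_bigr => p _; rewrite pderZ mulrC.
Qed.

Let ltransD x f g : ltrans x (f + g) = ltrans x f + ltrans x g.
Proof. by apply: polyfun_ext => y; rewrite polyfunD !ltransE. Qed.
Let ltransZ x a f : ltrans x (a *: f) = a *: ltrans x f.
Proof. by apply: polyfun_ext => y; rewrite polyfunZ !ltransE. Qed.
Let ltransM x f g : ltrans x (f * g) = ltrans x f * ltrans x g.
Proof. by apply: polyfun_ext => y; rewrite polyfunM !ltransE. Qed.

Let rconvD Y f g : rconv Y (f + g) = rconv Y f + rconv Y g.
Proof.
by apply: polyfun_ext => x; rewrite polyfunD !rconvE ltransD pderD.
Qed.
Let rconvZ Y a f : rconv Y (a *: f) = a *: rconv Y f.
Proof.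
by apply: polyfun_ext => x; rewrite polyfunZ !rconvE ltransZ pderZ.
Qed.
Let rconvM Y f g : rconv Y (f * g) = f * rconv Y g + rconv Y f * g.
Proof.
apply: polyfun_ext => x; rewrite polyfunD !polyfunM !rconvE ltransM point_derM.
by rewrite !ltransE mulg1.
Qed.
Let rconv1 Y f : rconv Y f 1%g = Y f.
Proof.
by rewrite rconvE; congr (Y _); apply: polyfun_ext => y; rewrite ltransE mul1g.
Qed.
Let ltrans_rconv x Y f : ltrans x (rconv Y f) = rconv Y (ltrans x f).
Proof.
apply: polyfun_ext => y; rewrite ltransE !rconvE; congr (Y _).
by apply: polyfun_ext => z; rewrite !ltransE mulgA.
Qed.

Let bracketL X Y a f g : let B f := convol X Y f - convol Y X f in
  B (a *: f + g) = a * B f + B g.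
Proof.
by rewrite /= !convolE !rconvD !rconvZ !pderD !pderZ; ring.
Qed.

Let convolM X Y f g : convol X Y (f * g) =
  f 1%g * convol X Y g + convol X Y f * g 1%g + (X f * Y g + Y f * X g).
Proof.
by rewrite !convolE rconvM pderD !point_derM !rconv1; ring.
Qed.

Let bracketM X Y f g : let B f := convol X Y f - convol Y X f in
  B (f * g) = f 1%g * B g + B f * g 1%g.
Proof.
by rewrite /= !convolM; ring.
Qed.

Definition point_der_bracket X Y : point_der G :=
  @PointDer _ _ (fun f => convol X Y f - convol Y X f)
    (bracketL X Y) (bracketM X Y).

Lemma point_der_bracketE X Y f :
  point_der_bracket X Y f = convol X Y f - convol Y X f.
Proof. by []. Qed.

Let convA X Y Z f : X (rconv (point_der_bracket Y Z) f) =
  X (rconv Y (rconv Z f)) - X (rconv Z (rconv Y f)).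
Proof.
rewrite -[RHS]/(_) -mulN1r -pderZ -pderD; congr (X _).
apply: polyfun_ext => x; rewrite polyfunD polyfunZ mulN1r !rconvE.
by rewrite point_der_bracketE !convolE !ltrans_rconv.
Qed.

Let bracket_bilinear : bilinear_map point_der_bracket.
Proof.
split=> a X Y Z; apply: point_der_ext => f;
  rewrite point_derDE point_derZE !point_der_bracketE !convolE;
  rewrite !(point_derDE, point_derZE).
  rewrite (_ : rconv (a *: X + Y) f = a *: rconv X f + rconv Y f); last first.
    apply: polyfun_ext => x; rewrite polyfunD polyfunZ !rconvE.
    by rewrite point_derDE point_derZE.
  by rewrite pderD pderZ; ring.
rewrite (_ : rconv (a *: Y + Z) f = a *: rconv Y f + rconv Z f); last first.
  apply: polyfun_ext => x; rewrite polyfunD polyfunZ !rconvE.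
  by rewrite point_derDE point_derZE.
by rewrite pderD pderZ; ring.
Qed.

Let bracketxx X : point_der_bracket X X = 0.
Proof. by apply: point_der_ext => f; rewrite point_der_bracketE subrr. Qed.

Let bracket_jacobi X Y Z :
  point_der_bracket X (point_der_bracket Y Z) +
  point_der_bracket Y (point_der_bracket Z X) +
  point_der_bracket Z (point_der_bracket X Y) = 0.
Proof.
apply: point_der_ext => f; rewrite !point_derDE !point_der_bracketE !convolE.
by rewrite !convA !point_der_bracketE !convolE -[RHS]/(0 : K); ring.
Qed.

HB.instance Definition _ := Lmodule_isLie.Build K (point_der G)
  bracket_bilinear bracketxx bracket_jacobi.

End LieAlgebraOfGroup.

(* lact psi phi is the left action of psi in G2 on phi in G1, and ract psi phi
   is the right action of phi on psi. *)
Record matched_pair (K : fieldType) (G1 G2 : affine_group K) := MatchedPair {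
  lact : G2 -> G1 -> G1;
  ract : G2 -> G1 -> G2;
  lact_poly : forall i, polynomial_fun (pair_coord (@acoord K G2) (@acoord K G1))
    (fun xy => acoord (lact xy.1 xy.2) i);
  ract_poly : forall i, polynomial_fun (pair_coord (@acoord K G2) (@acoord K G1))
    (fun xy => acoord (ract xy.1 xy.2) i);
  lact1 : forall phi, lact 1%g phi = phi;
  lactM : forall psi1 psi2 phi,
    lact (psi1 * psi2)%g phi = lact psi1 (lact psi2 phi);
  ract1 : forall psi, ract psi 1%g = psi;
  ractM : forall psi phi1 phi2,
    ract psi (phi1 * phi2)%g = ract (ract psi phi1) phi2;
  lact_mul : forall psi phi1 phi2,
    lact psi (phi1 * phi2)%g = (lact psi phi1 * lact (ract psi phi1) phi2)%g;
  lact_one : forall psi, lact psi 1%g = 1%g;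
  ract_mul : forall psi1 psi2 phi,
    ract (psi1 * psi2)%g phi = (ract psi1 (lact psi2 phi) * ract psi2 phi)%g;
  ract_one : forall phi, ract 1%g phi = 1%g }.

Section MatchedPairTheory.
Variables (K : fieldType) (G1 G2 : affine_group K) (M : matched_pair G1 G2).

(* The element f^<0> ⊗ f^<1>. *)
Definition polyfun_coaction (f : 'P(G2)) : 'P(G2) ⊗ 'P(G1) :=
  tensor_of (fun psi phi => f (ract M psi phi)).

Lemma polyfun_coactionE f psi phi :
  teval (polyfun_coaction f) psi phi = f (ract M psi phi).
Proof.
rewrite tensor_ofP //.
exact: (@polyfun_comp _ _ _ _ _ (fun xy : G2 * G1 => ract M xy.1 xy.2) f
  (@ract_poly _ _ _ M)).
Qed.

Lemma lact_polyl psi i :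
  polynomial_fun (@acoord K G1) (fun phi => acoord (lact M psi phi) i).
Proof.
have [p pE] := lact_poly M i.
suff : polynomial_fun (@acoord K G1) (fun phi =>
    p.@[pair_coord (@acoord K G2) (@acoord K G1) (psi, phi)]).
  by case=> q qE; exists q => phi; rewrite -qE -pE.
apply: polynomial_comp => j; rewrite /pair_coord.
case: (fintype.split j) => k; first by exists (acoord psi k)%:MP => phi; rewrite mevalC.
by exists 'X_k => phi; rewrite mevalXU.
Qed.

Definition polyfun_lact (psi : G2) (f : 'P(G1)) : 'P(G1) :=
  PolyFun (polyfun_comp f (lact_polyl psi)).

Let lact_lieL psi (X : point_der G1) a f g :
  X (polyfun_lact psi (a *: f + g)) =
  a * X (polyfun_lact psi f) + X (polyfun_lact psi g).
Proof.
by rewrite -pderZ -pderD; congr (X _); apply: polyfun_ext.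
Qed.

Let lact_lieM psi (X : point_der G1) f g :
  X (polyfun_lact psi (f * g)) =
  f 1%g * X (polyfun_lact psi g) + X (polyfun_lact psi f) * g 1%g.
Proof.
have E (h : 'P(G1)) : h 1%g = polyfun_lact psi h 1%g by rewrite /= lact_one.
by rewrite (E f) (E g) -point_derM; congr (X _); apply: polyfun_ext.
Qed.

(* psi ▷ X, the differential at the identity of phi |-> psi ▷ phi. *)
Definition lact_lie (psi : G2) (X : point_der G1) : point_der G1 :=
  @PointDer _ _ (fun f => X (polyfun_lact psi f))
    (lact_lieL psi X) (lact_lieM psi X).

Record determined_action
    (act : env (point_der G1) -> 'P(G2) -> 'P(G2)) : Prop := DeterminedAction {
  da_action :
    left_action (U := env_hopf (point_der G1)) (F := polyfun_hopf G2) act;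
  da_gen : forall (X : point_der G1) (f : 'P(G2)),
    act (env_gen X) f = \Sw_(f0, f1 <- polyfun_coaction f) X f1 *: f0 }.

Record extended_coaction (n : nat) (X : 'I_n -> point_der G1)
    (f : 'I_n -> 'I_n -> 'P(G2)) (act : env (point_der G1) -> 'P(G2) -> 'P(G2))
    (co : env (point_der G1) -> env (point_der G1) ⊗ 'P(G2)) : Prop :=
  ExtendedCoaction {
  ec_linear : linear co;
  ec_gen : forall i, co (env_gen (X i)) = \sum_j env_gen (X j) ⊗ f j i;
  ec1 : co 1 = 1 ⊗ 1;
  ecM : coact_multiplicative (U := env_hopf (point_der G1))
          (F := polyfun_hopf G2) act co }.

End MatchedPairTheory.

Definition is_basis (K : fieldType) (V : lmodType K) (n : nat) (e : 'I_n -> V) :=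
  forall v, exists! a : 'I_n -> K, v = \sum_i a i *: e i.

(* Main.v *)
Require Import Defs.
From HB Require Import structures.
From mathcomp Require Import all_boot all_order all_algebra.
From mathcomp Require Import boolp classical_sets mpoly reals complex ring.

Set Implicit Arguments.
Unset Strict Implicit.
Unset Printing Implicit Defensive.

Import GRing.Theory.
Local Open Scope ring_scope.

(* A matched pair of groups differentiates to an action d of g1 on P(G2) by
   derivations and a coaction c : g1 -> g1 ⊗ P(G2), c(X) being the function
   psi |-> psi ▷ X; the chain rule, applied to the axioms of the matched pair,
   gives the compatibilities of d and c on g1.  These integrate to U(g1) for any
   commutative Hopf algebra F in place of P(G2): for each U(g1)-module V, the
   operators v ⊗ f |-> sum y v ⊗ p f + v ⊗ x ▷ f, where c(x) = sum y ⊗ p, make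
   V ⊗ F a U(g1)-module, and the extended coaction is u |-> u (1 ⊗ 1) for
   V = U(g1).  As u acts on V ⊗ F by v ⊗ f |-> u_(1)<0> v ⊗ u_(1)<1> (u_(2) ▷ f),
   the axioms of a matched pair of Hopf algebras say that some maps between the
   V ⊗ F, for V one of F, U(g1), U(g1) ⊗ U(g1), U(g1) ⊗ F, are U(g1)-linear,
   which is checked on g1. *)

(** * Linear maps and Sweedler sums *)

Section Linear.
Variables (K : fieldType).
Implicit Types (U V W M : lmodType K).

Lemma lin_id V : linear (fun x : V => x).
Proof. by []. Qed.

Lemma lin_comp U V W (h : V -> W) (f : U -> V) :
  linear h -> linear f -> linear (fun x => h (f x)).
Proof. by move=> hl fl a x y; rewrite fl hl. Qed.

Lemma scal_comp V W (h : W -> K) (f : V -> W) :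
  scalar h -> linear f -> scalar (fun x => h (f x)).
Proof. by move=> hl fl a x y; rewrite fl hl. Qed.

Lemma lin_bilinl U V W M (h : V -> W -> M) (f : U -> V) w :
  bilinear_map h -> linear f -> linear (fun x => h (f x) w).
Proof. by move=> [hl _] fl a x y; rewrite fl hl. Qed.

Lemma lin_bilinr U V W M (h : V -> W -> M) (f : U -> W) v :
  bilinear_map h -> linear f -> linear (fun x => h v (f x)).
Proof. by move=> [_ hl] fl a x y; rewrite fl hl. Qed.

Lemma linB V W (f : V -> W) : linear f -> {morph f : x y / x - y}.
Proof.
by move=> fl x y; rewrite -[x - y]addrC -scaleN1r fl scaleN1r addrC.
Qed.

Lemma lin0 V W (f : V -> W) : linear f -> f 0 = 0.
Proof. by move=> fl; rewrite -[X in f X](subrr 0) linB // subrr. Qed.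

Lemma linD V W (f : V -> W) : linear f -> {morph f : x y / x + y}.
Proof. by move=> fl x y; have := fl 1 x y; rewrite !scale1r. Qed.

Lemma linZ V W (f : V -> W) : linear f -> forall a, {morph f : x / a *: x}.
Proof. by move=> fl a x; have := fl a x 0; rewrite (lin0 fl) !addr0. Qed.

Lemma lin_bigsum V W (f : V -> W) I (r : seq I) (F : I -> V) :
  linear f -> f (\sum_(i <- r) F i) = \sum_(i <- r) f (F i).
Proof. by move=> fl; exact: (big_morph f (linD fl) (lin0 fl)). Qed.

Lemma lin_add V W (f g : V -> W) :
  linear f -> linear g -> linear (fun x => f x + g x).
Proof. by move=> fl gl a x y; rewrite fl gl scalerDr addrACA. Qed.

Lemma lin_opp V W (f : V -> W) : linear f -> linear (fun x => - f x).
Proof. by move=> fl a x y; rewrite fl opprD scalerN. Qed.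

Lemma lin_scale V W (f : V -> W) k : linear f -> linear (fun x => k *: f x).
Proof. by move=> fl a x y; rewrite fl scalerDr !scalerA mulrC. Qed.

Lemma lin_scalel V W (f : V -> K) (w : W) :
  scalar f -> linear (fun x => f x *: w).
Proof. by move=> fl a x y; rewrite fl scalerDl scalerA. Qed.

Lemma lin_sum V W I (r : seq I) (f : V -> I -> W) :
  (forall i, linear (f^~ i)) -> linear (fun x => \sum_(i <- r) f x i).
Proof.
move=> fl a x y; rewrite scaler_sumr -big_split /=.
by apply: eq_bigr => i _; apply: fl.
Qed.

Lemma lin_mull V (A : algType K) (f : V -> A) c :
  linear f -> linear (fun x => f x * c).
Proof. by move=> fl a x y; rewrite fl mulrDl scalerAl. Qed.

Lemma lin_mulr V (A : algType K) (f : V -> A) c :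
  linear f -> linear (fun x => c * f x).
Proof. by move=> fl a x y; rewrite fl mulrDr scalerAr. Qed.

Lemma bilinP V W M (f : V -> W -> M) :
  (forall w, linear (fun v => f v w)) -> (forall v, linear (fun w => f v w)) ->
  bilinear_map f.
Proof. by move=> fl fr; split=> [a v v' w|a v w w']; [apply: fl|apply: fr]. Qed.

Lemma lin_tensl U V W (f : U -> V) (w : W) :
  linear f -> linear (fun x => f x ⊗ w).
Proof. exact/lin_bilinl/tens_bilinear. Qed.

Lemma lin_tensr U V W (f : U -> W) (v : V) :
  linear f -> linear (fun x => v ⊗ f x).
Proof. exact/lin_bilinr/tens_bilinear. Qed.

Lemma lin_sw_body U V W M (F : U -> V -> W -> M) t :
  (forall a b, linear (fun x => F x a b)) ->
  linear (fun x => \Sw_(a, b <- t) F x a b).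
Proof. by move=> Fl; apply: lin_sum => p; apply: Fl. Qed.

Lemma lin_sw_arg U V W M (F : V -> W -> M) (f : U -> V ⊗ W) :
  bilinear_map F -> linear f -> linear (fun x => \Sw_(a, b <- f x) F a b).
Proof. by move=> Fb fl; apply: lin_comp (sweedler_linear Fb) fl. Qed.

End Linear.

(* Linear and bilinear maps among the hypotheses are recognized; lin_extra is a
   hook for further ones. *)
Ltac lin_extra := fail.
Ltac lin1 :=
  cbv beta;
  lazymatch goal with
  | |- bilinear_map _ => first [assumption | apply: bilinP => ?]
  | |- GRing.linear_for _ (fun x => x) => exact: lin_id
  | |- GRing.linear_for _ (fun x => tens _ _) =>
      first [apply: lin_tensl | apply: lin_tensr]
  | |- GRing.linear_for _ (fun x => sweedler _ _) =>
      first [apply: lin_sw_body => ? ? | apply: lin_sw_arg]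
  | |- GRing.linear_for _ (fun x => GRing.add _ _) => apply: lin_add
  | |- GRing.linear_for _ (fun x => GRing.opp _) => apply: lin_opp
  | |- GRing.linear_for _ (fun x => GRing.scale _ _) =>
      first [apply: lin_scale | apply: lin_scalel]
  | |- _ => first
    [ assumption
    | match goal with
      | H : bilinear_map ?h |- GRing.linear_for _ (?h _) =>
          exact: (lin_bilinr _ H (@lin_id _ _))
      | |- GRing.linear_for _ (tens _) => exact: (lin_tensr _ (@lin_id _ _))
      | |- GRing.linear_for _ (GRing.mul _) => exact: (lin_mulr _ (@lin_id _ _))
      | H : bilinear_map ?h |- GRing.linear_for _ (fun x => ?h _ _) =>
          first [apply: (lin_bilinl _ H) | apply: (lin_bilinr _ H)]
      | H : GRing.linear_for _ ?h |- GRing.linear_for _ (fun x => ?h _) =>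
          first [apply: (lin_comp H) | apply: (scal_comp H)]
      | |- GRing.linear_for _ (fun x => GRing.mul _ _) =>
          first [apply: lin_mull | apply: lin_mulr]
      end
    | lin_extra
    | apply: lin_sum => ? ]
  end.
Ltac lin := repeat lin1.

Section SweedlerCalculus.
Variables (K : fieldType) (V W : lmodType K).

Lemma sw_map (M N : lmodType K) (h : M -> N) (t : V ⊗ W) (f : V -> W -> M) :
  linear h -> h (\Sw_(a, b <- t) f a b) = \Sw_(a, b <- t) h (f a b).
Proof. by move=> hl; exact: (big_morph h (linD hl) (lin0 hl)). Qed.

Lemma sw_sw (V' W' M : lmodType K) (t : V ⊗ W) (h : V -> W -> V' ⊗ W')
    (f : V' -> W' -> M) : bilinear_map f ->
  \Sw_(a, b <- \Sw_(c, d <- t) h c d) f a b =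
  \Sw_(c, d <- t) \Sw_(a, b <- h c d) f a b.
Proof. by move=> fb; rewrite (sw_map _ _ (sweedler_linear fb)). Qed.

Lemma eq_sw (M : zmodType) (t : V ⊗ W) (f g : V -> W -> M) :
  (forall a b, f a b = g a b) -> \Sw_(a, b <- t) f a b = \Sw_(a, b <- t) g a b.
Proof. by move=> fg; apply: eq_bigr => p _. Qed.

Lemma sw_exchange (V' W' M : lmodType K) (s : V ⊗ W) (t : V' ⊗ W')
    (f : V -> W -> V' -> W' -> M) :
  \Sw_(a, b <- s) \Sw_(c, d <- t) f a b c d =
  \Sw_(c, d <- t) \Sw_(a, b <- s) f a b c d.
Proof. exact: exchange_big. Qed.

Lemma swD (M : zmodType) (t : V ⊗ W) (f g : V -> W -> M) :
  \Sw_(a, b <- t) (f a b + g a b) =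
  \Sw_(a, b <- t) f a b + \Sw_(a, b <- t) g a b.
Proof. exact: big_split. Qed.

Lemma swN (M : zmodType) (t : V ⊗ W) (f : V -> W -> M) :
  \Sw_(a, b <- t) - f a b = - \Sw_(a, b <- t) f a b.
Proof. exact: sumrN. Qed.

Lemma swB (M : zmodType) (t : V ⊗ W) (f g : V -> W -> M) :
  \Sw_(a, b <- t) (f a b - g a b) =
  \Sw_(a, b <- t) f a b - \Sw_(a, b <- t) g a b.
Proof. by rewrite swD swN. Qed.

Lemma sw_id (t : V ⊗ W) : \Sw_(a, b <- t) a ⊗ b = t.
Proof. exact: esym (tens_repr t). Qed.

End SweedlerCalculus.

Lemma sw_mul (K : fieldType) (A B : algType K) (M : lmodType K) (s t : A ⊗ B)
    (G : A -> B -> M) : bilinear_map G ->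
  \Sw_(a, b <- s * t) G a b =
  \Sw_(a, b <- s) \Sw_(c, d <- t) G (a * c) (b * d).
Proof.
move=> Gb; rewrite sw_sw //; apply: eq_sw => a b.
by rewrite sw_sw //; apply: eq_sw => c d; rewrite sweedler_tens.
Qed.

(** * Modules over the enveloping algebra and its Hopf structure *)

(** Bundling makes the linear endomorphisms a ring, possibly the zero one, that can be the target of
    [env_lift]: a representation of g is a Lie morphism into it. *)
Record lin_end (K : fieldType) (V : lmodType K) := LinEnd {
  lin_end_val :> V -> V;
  lin_endP : linear lin_end_val }.

Section LinEnd.
Variables (K : fieldType) (V : lmodType K).
Implicit Types (f g h : lin_end V).

Lemma lin_end_ext f g : (forall v, f v = g v) -> f = g.
Proof.
case: f g => [f fP] [g gP] /= /funext fg; rewrite fg in fP *.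
by congr LinEnd; apply: Prop_irrelevance.
Qed.

HB.instance Definition _ := gen_eqMixin (lin_end V).
HB.instance Definition _ := gen_choiceMixin (lin_end V).

Let zeroP : linear (fun _ : V => 0 : V).
Proof. by move=> a x y; rewrite scaler0 addr0. Qed.

Definition lin_end_zero := LinEnd zeroP.
Definition lin_end_one := LinEnd (@lin_id K V).
Definition lin_end_opp f := LinEnd (lin_opp (lin_endP f)).
Definition lin_end_add f g := LinEnd (lin_add (lin_endP f) (lin_endP g)).
Definition lin_end_mul f g := LinEnd (lin_comp (lin_endP f) (lin_endP g)).
Definition lin_end_scalar a := LinEnd (lin_scale a (@lin_id K V)).

Let addA : associative lin_end_add.
Proof. by move=> f g h; apply: lin_end_ext => v /=; rewrite addrA. Qed.
Let addC : commutative lin_end_add.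
Proof. by move=> f g; apply: lin_end_ext => v /=; rewrite addrC. Qed.
Let add0 : left_id lin_end_zero lin_end_add.
Proof. by move=> f; apply: lin_end_ext => v /=; rewrite add0r. Qed.
Let addN : left_inverse lin_end_zero lin_end_opp lin_end_add.
Proof. by move=> f; apply: lin_end_ext => v /=; rewrite addNr. Qed.
HB.instance Definition _ :=
  GRing.isZmodule.Build (lin_end V) addA addC add0 addN.

Let mulA : associative lin_end_mul.
Proof. by move=> f g h; apply: lin_end_ext. Qed.
Let mul1 : left_id lin_end_one lin_end_mul.
Proof. by move=> f; apply: lin_end_ext. Qed.
Let mulr1 : right_id lin_end_one lin_end_mul.
Proof. by move=> f; apply: lin_end_ext. Qed.
Let mulDl : left_distributive lin_end_mul lin_end_add.
Proof. by move=> f g h; apply: lin_end_ext. Qed.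
Let mulDr : right_distributive lin_end_mul lin_end_add.
Proof.
by move=> f g h; apply: lin_end_ext => v /=; rewrite (linD (lin_endP f)).
Qed.
HB.instance Definition _ :=
  GRing.Zmodule_isPzRing.Build (lin_end V) mulA mul1 mulr1 mulDl mulDr.

End LinEnd.

Record lie_rep (K : fieldType) (g : lieAlgType K) (V : lmodType K)
    (r : g -> V -> V) : Prop := LieRep {
  rep_bilinear : bilinear_map r;
  rep_bracket : forall x y v,
    r (lie_bracket x y) v = r x (r y v) - r y (r x v) }.

Record env_module (K : fieldType) (g : lieAlgType K) (V : lmodType K)
    (m : env g -> V -> V) : Prop := EnvModule {
  emod_bilinear : bilinear_map m;
  emod1 : forall v, m 1 v = v;
  emodM : forall u w v, m (u * w) v = m u (m w v) }.

(** * Induction on U(g) and extension of representations of g *)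

Section EnvInduction.
Variables (K : fieldType) (g : lieAlgType K).

(** By induction on [u], left multiplication by [u] preserves [P]; applied to 1, this is the claim.
    Proofs on U(g) are thus reduced to left multiplication by a single generator. *)
Lemma env_left_ind (P : env g -> Prop) :
  P 1 -> (forall a u v, P u -> P v -> P (a *: u + v)) ->
  (forall x v, P v -> P (env_gen x * v)) -> forall u, P u.
Proof.
move=> P1 PL PM u; rewrite -[u]mulr1; move: (1) P1.
elim/env_ind: u => [|x|a u w Pu Pw|u w Pu Pw] v Pv.
- by rewrite mul1r.
- exact: PM.
- by rewrite mulrDl -scalerAl; apply: PL; [apply: Pu | apply: Pw].
- by rewrite -mulrA; apply/Pu/Pw.
Qed.

(** The elements where two linear maps agree form a subspace, so [env_left_ind] applies. Most
    identities on U(g) below are proved by showing that both sides obey the same recursion. *)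
Lemma env_ext (M : lmodType K) (f h : env g -> M) : linear f -> linear h ->
  f 1 = h 1 ->
  (forall x v, f v = h v -> f (env_gen x * v) = h (env_gen x * v)) -> f =1 h.
Proof.
move=> fl hl fh1 fhM; apply: env_left_ind => // a u v fhu fhv.
by rewrite fl hl fhu fhv.
Qed.

(** This is the universal property of U(g), applied to the ring [lin_end V] with scalars acting as
    homotheties. *)
Lemma env_moduleP (V : lmodType K) (r : g -> V -> V) : lie_rep r ->
  exists m : env g -> V -> V,
    env_module m /\ forall x v, m (env_gen x) v = r x v.
Proof.
move=> [rb rB].
pose phi x : lin_end V := LinEnd (lin_bilinr x rb (@lin_id K V)).
have h : env_hom (@lin_end_scalar K V) phi.
  split=> [|a b|a b|a f|x y|a x|x y]; apply: lin_end_ext => v /=.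
  - exact: scale1r.
  - exact: scalerDl.
  - by rewrite scalerA.
  - by rewrite (linZ (lin_endP f)).
  - exact: (bilinDl rb).
  - exact: (bilinZl rb).
  - exact: rB.
exists (fun u => lin_end_val (env_lift (@lin_end_scalar K V) phi u)); 
  split=> [|x v].
  split=> [|v|u w v].
  - apply: bilinP => [v|u]; last exact: lin_endP.
    by move=> a u w; rewrite (env_liftD h) (env_liftZ h).
  - by rewrite (env_lift1 h).
  - by rewrite (env_liftM h).
by rewrite (env_lift_gen h).
Qed.

Lemma env_module_ext (V : lmodType K) (m m' : env g -> V -> V) :
  env_module m -> env_module m' ->
  (forall x v, m (env_gen x) v = m' (env_gen x) v) -> m =2 m'.
Proof.
move=> [mb m1 mM] [mb' m1' mM'] E u v; move: u; apply: env_ext.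
- by lin.
- by lin.
- by rewrite m1 m1'.
- by move=> x u IH; rewrite mM mM' IH E.
Qed.

End EnvInduction.

(** * The Hopf algebra U(g) *)

Section EnvHopf.
Variables (K : fieldType) (g : lieAlgType K).
Local Notation U := (env g).
Implicit Types (u v : U).

Lemma env_counit_scalar : scalar (@env_counit K g).
Proof.
move=> a u v; have h := env_counit_hom g.
by rewrite /env_counit (env_liftD h) (env_liftZ h).
Qed.

Lemma env_comul_linear : linear (@env_comul K g).
Proof.
move=> a u v; have h := env_comul_hom g.
by rewrite /env_comul (env_liftD h) (env_liftZ h) -tens1E -tensor_scaleAl mul1r.
Qed.

Lemma env_antipode_linear : linear (@env_antipode K g).
Proof.
move=> a u v; have h := env_antipode_hom g.
rewrite /env_antipode (env_liftD h) (env_liftZ h); congr (_ + _).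
by rewrite -[LHS]/((_ : U) * (a *: (1 : U))) -scalerAr mulr1.
Qed.

Lemma env_comul1 : env_comul (1 : U) = 1 ⊗ 1.
Proof. exact: (env_lift1 (env_comul_hom g)). Qed.

Lemma env_counit1 : env_counit (1 : U) = 1.
Proof. exact: (env_lift1 (env_counit_hom g)). Qed.

Lemma env_antipode1 : env_antipode (1 : U) = 1.
Proof. exact: (env_lift1 (env_antipode_hom g)). Qed.

Lemma env_comulM u v : env_comul (u * v) = env_comul u * env_comul v.
Proof. exact: (env_liftM (env_comul_hom g)). Qed.

Lemma env_counitM u v : env_counit (u * v) = env_counit u * env_counit v.
Proof. exact: (env_liftM (env_counit_hom g)). Qed.

Lemma env_antipodeM u v : env_antipode (u * v) = env_antipode v * env_antipode u.
Proof. exact: (env_liftM (env_antipode_hom g)). Qed.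

Lemma env_counit_gen x : env_counit (env_gen x : U) = 0.
Proof. exact: (env_lift_gen (env_counit_hom g)). Qed.

Lemma env_antipode_gen x : env_antipode (env_gen x : U) = - env_gen x.
Proof. exact: (env_lift_gen (env_antipode_hom g)). Qed.

Lemma env_comul_gen x : env_comul (env_gen x : U) = env_gen x ⊗ 1 + 1 ⊗ env_gen x.
Proof. exact: (env_lift_gen (env_comul_hom g)). Qed.

(** As x is primitive, multiplying by its coproduct is letting x act on either leg in turn. This is
    the form in which inductions by [env_ext] use the coproduct. *)
Lemma env_comul_genM x v : env_comul (env_gen x * v) =
  \Sw_(a, b <- env_comul v) ((env_gen x * a) ⊗ b + a ⊗ (env_gen x * b)).
Proof.
rewrite env_comulM env_comul_gen; move: (env_comul v).
apply: tensor_ext; first by move=> a s t; rewrite mulrDr tensor_scaleAr.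
  by lin.
move=> a b; rewrite sweedler_tens; last by lin.
by rewrite mulrDl !tensM !mul1r.
Qed.

End EnvHopf.

Ltac lin_extra ::=
  match goal with
  | |- GRing.linear_for _ (@env_comul _ _) => exact: env_comul_linear
  | |- GRing.linear_for _ (@env_antipode _ _) => exact: env_antipode_linear
  | |- GRing.linear_for _ (@env_counit _ _) => exact: env_counit_scalar
  | |- GRing.linear_for _ (@env_gen _ _) => exact: env_gen_linear
  | |- GRing.linear_for _ (fun x => env_comul _) =>
      apply: (lin_comp (@env_comul_linear _ _))
  | |- GRing.linear_for _ (fun x => env_antipode _) =>
      apply: (lin_comp (@env_antipode_linear _ _))
  | |- GRing.linear_for _ (fun x => env_gen _) =>
      apply: (lin_comp (@env_gen_linear _ _))
  | |- GRing.linear_for _ (fun x => env_counit _) =>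
      apply: (scal_comp (@env_counit_scalar _ _))
  end.

Ltac sw := repeat (rewrite sweedler_tens; last by lin).
Ltac sw_push := repeat (rewrite sw_sw; last by lin).

Section EnvHopfAlgebra.
Variables (K : fieldType) (g : lieAlgType K).
Local Notation U := (env g).
Implicit Types (u v : U).

(** Primitive elements have a symmetric coproduct, so U(g) is cocommutative. This gives one counit
    law from the other, and the last axiom of the matched pair. *)
Lemma env_comulC u : \Sw_(a, b <- env_comul u) b ⊗ a = env_comul u.
Proof.
move: u; apply: env_ext => [||| x v IH]; try by lin.
  by rewrite env_comul1; sw.
rewrite env_comul_genM -[in RHS]IH; sw_push; apply: eq_sw => a b.
rewrite sweedlerD; last by lin.
by sw; rewrite addrC.
Qed.

Lemma sw_comulC (M : lmodType K) (F : U -> U -> M) u : bilinear_map F ->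
  \Sw_(a, b <- env_comul u) F a b = \Sw_(a, b <- env_comul u) F b a.
Proof.
move=> Fb; rewrite -[in LHS]env_comulC; sw_push; apply: eq_sw => a b.
by sw.
Qed.

Lemma sw_comul_genM (M : lmodType K) (F : U -> U -> M) x v : bilinear_map F ->
  \Sw_(a, b <- env_comul (env_gen x * v)) F a b =
  \Sw_(a, b <- env_comul v) (F (env_gen x * a) b + F a (env_gen x * b)).
Proof.
move=> Fb; rewrite env_comul_genM; sw_push; apply: eq_sw => a b.
by rewrite (sweedlerD Fb); sw.
Qed.

Lemma env_comulA u :
  \Sw_(a, b <- env_comul u) env_comul a ⊗ b =
  \Sw_(a, b <- env_comul u) \Sw_(c, d <- env_comul b) a ⊗ c ⊗ d.
Proof.
move: u; apply: env_ext => [||| x v IH]; try by lin.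
  by rewrite env_comul1; sw; rewrite env_comul1; sw.
(* [T] is left multiplication by x ⊗ 1 ⊗ 1 + 1 ⊗ x ⊗ 1 + 1 ⊗ 1 ⊗ x; it takes each side of
   coassociativity from v to x v. *)
pose T (t : (U ⊗ U ⊗ U)%type) : (U ⊗ U ⊗ U)%type := \Sw_(s, c <- t) \Sw_(a, b <- s)
  ((env_gen x * a) ⊗ b ⊗ c + a ⊗ (env_gen x * b) ⊗ c + a ⊗ b ⊗ (env_gen x * c)).
have Tl : linear T by rewrite /T; lin.
transitivity (T (\Sw_(a, b <- env_comul v) env_comul a ⊗ b)).
  rewrite sw_comul_genM; last by lin.
  rewrite (sw_map (h := T)) //; apply: eq_sw => a b; rewrite /T; sw.
  rewrite env_comul_genM.
  move: (env_comul a); apply: tensor_ext; try by lin.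
  by move=> c d; sw; rewrite tens_addl.
rewrite IH (sw_map (h := T)) // sw_comul_genM; last by lin.
apply: eq_sw => a b; rewrite sw_comul_genM; last by lin.
cbv beta; rewrite (sw_map (h := T)) // -swD; apply: eq_sw => c d; rewrite /T; sw.
by rewrite addrA.
Qed.

Lemma env_counitl u : \Sw_(a, b <- env_comul u) env_counit a *: b = u.
Proof.
move: u; apply: env_ext => [||| x v IH]; try by lin.
  by rewrite env_comul1; sw; rewrite env_counit1 scale1r.
rewrite sw_comul_genM; last by lin.
rewrite -[X in _ = _ * X]IH sw_map; last by lin.
apply: eq_sw => a b.
by rewrite env_counitM env_counit_gen mul0r scale0r add0r scalerAr.
Qed.

Lemma env_counitr u : \Sw_(a, b <- env_comul u) env_counit b *: a = u.
Proof. by rewrite sw_comulC ?env_counitl //; lin. Qed.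

Lemma env_antipodel u :
  \Sw_(a, b <- env_comul u) env_antipode a * b = env_counit u *: 1.
Proof.
move: u; apply: env_ext => [||| x v IH]; try by lin.
  by rewrite env_comul1; sw; rewrite env_counit1 env_antipode1 scale1r mulr1.
rewrite sw_comul_genM; last by lin.
rewrite env_counitM env_counit_gen mul0r scale0r.
transitivity (\Sw_(a, b <- env_comul v) (0 : U)); last exact: big1.
apply: eq_sw => a b.
by rewrite env_antipodeM env_antipode_gen mulrN mulNr mulrA addNr.
Qed.

Lemma env_antipoder u :
  \Sw_(a, b <- env_comul u) a * env_antipode b = env_counit u *: 1.
Proof.
move: u; apply: env_ext => [||| x v IH]; try by lin.
  by rewrite env_comul1; sw; rewrite env_counit1 env_antipode1 scale1r mulr1.
rewrite sw_comul_genM; last by lin.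
rewrite env_counitM env_counit_gen mul0r scale0r swD.
(* As S(x b) = - S(b) x, the sum is the commutator of x with the sum of the a S(b), which is a
   scalar by induction. *)
transitivity (env_gen x * (env_counit v *: 1) - (env_counit v *: 1) * env_gen x).
  rewrite -IH; congr (_ + _).
    by rewrite sw_map; [apply: eq_sw => a b; rewrite mulrA | lin].
  rewrite (sw_map (h := fun z => - (z * env_gen x))); last by lin.
  by apply: eq_sw => a b; rewrite env_antipodeM env_antipode_gen !mulrN mulrA.
by rewrite -scalerAl -scalerAr mulr1 mul1r subrr.
Qed.

Lemma env_hopfP : hopf_algebra (env_hopf g).
Proof.
split; [exact: env_comul_linear | exact: env_counit_scalar
  | exact: env_antipode_linear | exact: env_comulA | exact: env_counitl
  | exact: env_counitr | exact: env_comul1 | exact: env_comulM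
  | exact: env_counit1 | exact: env_counitM | exact: env_antipodel
  | exact: env_antipoder].
Qed.

End EnvHopfAlgebra.

(** * Integration of infinitesimal matched pairs *)

(** These are the axioms of a matched pair of Hopf algebras read on primitive elements. In
    particular, [imp_bracket] is what multiplicativity of the coaction gives on xy - yx when F is
    commutative, and [imp_comul] is the coproduct axiom for x ⊗ 1 + 1 ⊗ x. *)
Record infinitesimal_matched_pair (K : fieldType) (g : lieAlgType K)
    (F : hopf_data K) (d : g -> F -> F) (c : g -> g ⊗ F) : Prop :=
  InfinitesimalMatchedPair {
  imp_rep : lie_rep d;
  imp_der : forall x f h, d x (f * h) = d x f * h + f * d x h;
  imp_linear : linear c;
  imp_coactA : forall x, \Sw_(y, p <- c x) c y ⊗ p =
    \Sw_(y, p <- c x) \Sw_(p1, p2 <- comul p) y ⊗ p1 ⊗ p2;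
  imp_coact_counit : forall x, \Sw_(y, p <- c x) counit p *: y = x;
  imp_bracket : forall x y, c (lie_bracket x y) =
    \Sw_(x0, p <- c x) \Sw_(y0, q <- c y) lie_bracket x0 y0 ⊗ (p * q) +
    \Sw_(y0, q <- c y) y0 ⊗ d x q - \Sw_(x0, p <- c x) x0 ⊗ d y p;
  imp_comul : forall x f, comul (d x f) =
    \Sw_(f1, f2 <- comul f)
      (\Sw_(y, p <- c x) d y f1 ⊗ (p * f2) + f1 ⊗ d x f2);
  imp_counit : forall x f, counit (d x f) = 0 }.

Section Integration.
Variables (K : fieldType) (g : lieAlgType K) (F : hopf_data K).
Variables (d : g -> F -> F) (c : g -> g ⊗ F).
Hypotheses (HF : hopf_algebra F) (mulFC : commutative (@GRing.mul F)).
Hypothesis dc : infinitesimal_matched_pair d c.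
Local Notation U := (env g).

Let db : bilinear_map d := rep_bilinear (imp_rep dc).
Let cl : linear c := imp_linear dc.
Let Dl : linear (@comul K F) := comul_linear HF.
Let el : scalar (@counit K F) := counit_scalar HF.
Let gl : linear (@env_gen K g) := @env_gen_linear K g.
Let bl : bilinear_map (@lie_bracket K g) := @lie_bracket_bilinear K g.

(* The semidirect action of g on V ⊗ F, for a U(g)-module V. *)
Definition semidirect (V : lmodType K) (m : U -> V -> V) (x : g) (t : V ⊗ F) :
    V ⊗ F :=
  \Sw_(v, f <- t)
    (\Sw_(y, p <- c x) m (env_gen y) v ⊗ (p * f) + v ⊗ d x f).

(** * The semidirect action is a representation *)

Section Semidirect.
Variables (V : lmodType K) (m : U -> V -> V).
Hypothesis Hm : env_module m.
Let mb : bilinear_map m := emod_bilinear Hm.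

Lemma semidirect_bilinear : bilinear_map (semidirect m).
Proof. by rewrite /semidirect; lin. Qed.
Let sb := semidirect_bilinear.

Lemma semidirect_tens x v f : semidirect m x (v ⊗ f) =
  \Sw_(y, p <- c x) m (env_gen y) v ⊗ (p * f) + v ⊗ d x f.
Proof. by rewrite /semidirect; sw. Qed.

(** Exchanging x and y exchanges the third and fourth terms, which therefore drop out of the
    commutator, by [cancel]. *)
Let semidirect2 x y v f : semidirect m x (semidirect m y (v ⊗ f)) =
  \Sw_(x0, p <- c x) \Sw_(y0, q <- c y)
    m (env_gen x0) (m (env_gen y0) v) ⊗ (p * q * f) +
  \Sw_(y0, q <- c y) m (env_gen y0) v ⊗ (d x q * f) +
  \Sw_(y0, q <- c y) m (env_gen y0) v ⊗ (q * d x f) +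
  \Sw_(x0, p <- c x) m (env_gen x0) v ⊗ (p * d y f) + v ⊗ d x (d y f).
Proof.
rewrite !semidirect_tens (bilinDr sb) semidirect_tens.
rewrite (sw_map (h := semidirect m x)); last by lin.
rewrite addrA; congr (_ + _ + _).
rewrite [X in X + _ + _]sw_exchange -!swD; apply: eq_sw => y0 q.
rewrite semidirect_tens (imp_der dc) tens_addr addrA.
by congr (_ + _ + _); apply: eq_sw => x0 p; rewrite mulrA.
Qed.

Let cancel (M : zmodType) (a1 a2 b1 b2 c1 c2 d1 d2 : M) :
  a1 + b1 + c1 + c2 + d1 - (a2 + b2 + c2 + c1 + d2) =
  a1 - a2 + b1 - b2 + (d1 - d2).
Proof.
apply/eqP; rewrite subr_eq; apply/eqP.
rewrite !addrA [RHS](ACl (1*3*10*9*5*(2*7)*(4*8)*(6*11)))%AC /=.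
by rewrite !addNr !addr0.
Qed.

(** In the commutator, the terms where [m] acts add up to the action of c([x, y]) by [imp_bracket],
    and the remaining ones to d([x, y]). Commutativity of F lets q p be replaced by p q, so that the
    products by [m] form a commutator. *)
Lemma semidirect_rep : lie_rep (semidirect m).
Proof.
split=> [|x y t]; first exact: sb.
move: t; apply: tensor_ext; try by lin.
move=> v f; rewrite !semidirect2 cancel semidirect_tens.
rewrite (rep_bracket (imp_rep dc)) tens_addr -scaleN1r tens_scaler scaleN1r.
congr (_ + _); rewrite (imp_bracket dc).
(* Summation of [G] is linear in the tensor c([x, y]), so the three terms of [imp_bracket] can be
   treated separately. *)
pose G z p := m (env_gen z) v ⊗ (p * f).
have Gl : linear (fun t => sweedler t G) by rewrite /G; lin.
rewrite [LHS](linB Gl) (linD Gl) !(sw_map (h := fun t => sweedler t G)) //.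
congr (_ + _ - _); last 2 first.
- by apply: eq_sw => y0 q; rewrite /G; sw.
- by apply: eq_sw => y0 q; rewrite /G; sw.
rewrite [X in _ - X]sw_exchange -swB; apply: eq_sw => x0 p.
rewrite (sw_map (h := fun t => sweedler t G)) // -swB.
apply: eq_sw => y0 q; rewrite /G; sw.
rewrite env_gen_bracket (linB (f := fun z => m z v)); last by lin.
rewrite !(emodM Hm) (mulFC q p) -scaleN1r tens_addl tens_scalel.
by rewrite scaleN1r.
Qed.

End Semidirect.

Lemma der1 x : d x 1 = 0.
Proof.
by apply: (addIr (d x 1)); rewrite add0r -{3}[1]mulr1 (imp_der dc) mul1r mulr1.
Qed.

Lemma env_mul_module : env_module (@GRing.mul U).
Proof.
by split=> [|v|u w v]; [lin | rewrite mul1r | rewrite mulrA].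
Qed.
Let Umod := env_mul_module.

(** * The axioms of a matched pair of Hopf algebras for U(g) and F *)

Section Structure.
Variables (act : U -> F -> F) (co : U -> U ⊗ F).
Hypotheses (Hact : env_module act)
  (act_gen : forall x f, act (env_gen x) f = d x f).
Hypotheses (col : linear co) (co1 : co 1 = 1 ⊗ 1)
  (co_genM : forall x v, co (env_gen x * v) = semidirect *%R x (co v)).

Let actb : bilinear_map act := emod_bilinear Hact.

Let act_genM x v f : act (env_gen x * v) f = d x (act v f).
Proof. by rewrite (emodM Hact) act_gen. Qed.

(** When x acts on a term of the right side, the Leibniz rule for [d] splits the result into three:
    the action on [a] and on [p] together give co(x u1), and the action on the last factor gives x
    u2. These are the two halves of the coproduct of x u. *)
Lemma semidirect_env (V : lmodType K) (m : U -> V -> V) (L : U -> V ⊗ F -> V ⊗ F) :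
  env_module m -> env_module L ->
  (forall x t, L (env_gen x) t = semidirect m x t) -> forall u v f,
  L u (v ⊗ f) =
  \Sw_(u1, u2 <- env_comul u) \Sw_(a, p <- co u1) m a v ⊗ (p * act u2 f).
Proof.
move=> Hm HL Lg u v f; have mb := emod_bilinear Hm; have Lb := emod_bilinear HL.
have sb := semidirect_bilinear Hm; have sU := semidirect_bilinear Umod.
move: u; apply: env_ext => [||| x u IH]; try by lin.
  rewrite (emod1 HL) env_comul1; sw; rewrite co1; sw.
  by rewrite (emod1 Hm) (emod1 Hact) mul1r.
rewrite (emodM HL) Lg IH (sw_map (h := semidirect m x)); last by lin.
rewrite sw_comul_genM; last by lin.
apply: eq_sw => u1 u2; rewrite co_genM act_genM; move: (act u2 f) => h.
move: (co u1); apply: tensor_ext; try by lin.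
move=> a p; sw; rewrite !semidirect_tens // (imp_der dc) tens_addr.
rewrite sweedlerD; last by lin.
sw; sw_push; rewrite addrA; congr (_ + _ + _).
by apply: eq_sw => y r; sw; rewrite (emodM Hm) mulrA.
Qed.

(** By [imp_comul], the coproduct of F is a morphism of U(g)-modules from F to F ⊗ F with the
    semidirect action, which [semidirect_env] expands. *)
Lemma comul_act u f : comul (act u f) =
  \Sw_(u1, u2 <- env_comul u) \Sw_(a, p <- co u1) \Sw_(f1, f2 <- comul f)
    act a f1 ⊗ (p * act u2 f2).
Proof.
have [L [HL Lg]] := env_moduleP (semidirect_rep Hact).
have Lb := emod_bilinear HL.
have -> : comul (act u f) = L u (comul f).
  move: u; apply: env_ext => [||| x u IH]; try by lin.
    by rewrite (emod1 Hact) (emod1 HL).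
  rewrite act_genM (imp_comul dc) IH (emodM HL) Lg; apply: eq_sw => f1 f2.
  by congr (_ + _); apply: eq_sw => y p; rewrite act_gen.
rewrite -[comul f in LHS]sw_id (sw_map (h := L u)); last by lin.
transitivity (\Sw_(f1, f2 <- comul f) \Sw_(u1, u2 <- env_comul u)
    \Sw_(a, p <- co u1) act a f1 ⊗ (p * act u2 f2)).
  by apply: eq_sw => f1 f2; apply: semidirect_env.
by rewrite sw_exchange; apply: eq_sw => u1 u2; apply: sw_exchange.
Qed.

(** Since co(w) = w (1 ⊗ 1) for the semidirect action on U(g) ⊗ F, associativity gives co(u v) = u
    co(v), which [semidirect_env] expands. *)
Lemma co_mul : coact_multiplicative (U := env_hopf g) act co.
Proof.
move=> u v; have [L [HL Lg]] := env_moduleP (semidirect_rep Umod).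
have Lb := emod_bilinear HL.
have coE w : co w = L w (1 ⊗ 1).
  move: w; apply: env_ext => [||| x w IH]; try by lin.
    by rewrite co1 (emod1 HL).
  by rewrite co_genM (emodM HL) Lg IH.
have -> : co (u * v) = L u (co v) by rewrite !coE (emodM HL).
rewrite -[co v in LHS]sw_id (sw_map (h := L u)); last by lin.
transitivity (\Sw_(b, f <- co v) \Sw_(u1, u2 <- env_comul u)
    \Sw_(a, p <- co u1) (a * b) ⊗ (p * act u2 f)).
  by apply: eq_sw => b f; apply: (semidirect_env Umod HL Lg).
by rewrite sw_exchange; apply: eq_sw => u1 u2; apply: sw_exchange.
Qed.

(** The maps co ⊗ id and id ⊗ Δ both commute with x, acting on (U(g) ⊗ F) ⊗ F by the semidirect
    action built on that of U(g) ⊗ F. The second one does so by [imp_comul] and by the coaction law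
    of [c] on g. *)
Lemma co_coassoc u : \Sw_(a, f <- co u) co a ⊗ f =
  \Sw_(a, f <- co u) \Sw_(f1, f2 <- comul f) a ⊗ f1 ⊗ f2.
Proof.
have [L [HL Lg]] := env_moduleP (semidirect_rep Umod).
have sU := semidirect_bilinear Umod; have sL := semidirect_bilinear HL.
move: u; apply: env_ext => [||| x u IH]; try by lin.
  by rewrite co1; sw; rewrite (comul1 HF) co1; sw.
transitivity (semidirect L x (\Sw_(a, f <- co u) co a ⊗ f)).
  rewrite co_genM; move: (co u); apply: tensor_ext; try by lin.
  move=> a f; sw; rewrite !semidirect_tens // sweedlerD; last by lin.
  sw; congr (_ + _); sw_push; apply: eq_sw => y p; sw.
  by rewrite co_genM Lg.
rewrite IH co_genM; move: (co u); apply: tensor_ext; try by lin.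
move=> a f; sw; rewrite !semidirect_tens // sweedlerD; last by lin.
sw; rewrite (imp_comul dc) (sw_map (h := semidirect L x)); last by lin.
sw_push.
(* This is [imp_coactA] transported by the map z ⊗ q ⊗ p |-> z a ⊗ q h1 ⊗ p h2. *)
have psi h1 h2 : \Sw_(y, p <- c x)
      (\Sw_(z, q <- c y) (env_gen z * a) ⊗ (q * h1)) ⊗ (p * h2) =
    \Sw_(y, p <- c x) \Sw_(p1, p2 <- comul p)
      (env_gen y * a) ⊗ (p1 * h1) ⊗ (p2 * h2).
  pose G s p : (U ⊗ F ⊗ F)%type :=
    (\Sw_(z, q <- s) (env_gen z * a) ⊗ (q * h1)) ⊗ (p * h2).
  have Gb : bilinear_map G by rewrite /G; lin.
  have := congr1 (fun t => sweedler t G) (imp_coactA dc x).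
  rewrite !(sw_map (h := fun t => sweedler t G)); try by lin.
  move=> E; transitivity (\Sw_(y, p <- c x) sweedler (c y ⊗ p) G).
    by apply: eq_sw => y p; sw.
  rewrite E; apply: eq_sw => y p.
  rewrite (sw_map (h := fun t => sweedler t G)); last by lin.
  by apply: eq_sw => p1 p2; rewrite /G; sw.
(* The three terms let x act on the factor U(g), on the first factor F and on the second one. *)
symmetry; transitivity (\Sw_(h1, h2 <- comul f) (\Sw_(y, p <- c x)
   (\Sw_(z, q <- c y) (env_gen z * a) ⊗ (q * h1)) ⊗ (p * h2) +
   (\Sw_(y, p <- c x) (a ⊗ d y h1) ⊗ (p * h2) + a ⊗ h1 ⊗ d x h2))).
  rewrite [RHS]swD; congr (_ + _); last first.
    apply: eq_sw => h1 h2; rewrite sweedlerD; last by lin.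
    by sw_push; sw; congr (_ + _); apply: eq_sw => y p; sw.
  rewrite (eq_sw _ psi) sw_exchange; apply: eq_sw => y p; sw.
  rewrite (comulM HF) sw_mul; last by lin.
  exact: sw_exchange.
apply: eq_sw => h1 h2; rewrite semidirect_tens // addrA -swD.
congr (_ + _); apply: eq_sw => y p.
by rewrite Lg semidirect_tens // tens_addl.
Qed.

(** The map id ⊗ ε commutes with x: the counit kills d x f, and [imp_coact_counit] contracts c(x)
    back to x. *)
Lemma co_counit u : \Sw_(a, f <- co u) counit f *: a = u.
Proof.
have sU := semidirect_bilinear Umod.
move: u; apply: env_ext => [||| x u IH]; try by lin.
  by rewrite co1; sw; rewrite (counit1 HF) scale1r.
rewrite -{2}IH co_genM; move: (co u); apply: tensor_ext; try by lin.
move=> a f; sw; rewrite semidirect_tens // sweedlerD; last by lin.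
sw; rewrite (imp_counit dc) scale0r addr0; sw_push.
rewrite -[x in RHS](imp_coact_counit dc).
rewrite (sw_map (h := fun z => env_gen z * (counit f *: a))); last by lin.
apply: eq_sw => y p; sw.
rewrite (counitM HF) (linZ gl) -scalerAr -scalerAl scalerA mulrC //.
Qed.

Lemma co_counit_env u : \Sw_(a, f <- co u) env_counit a *: f = env_counit u *: 1.
Proof.
have sU := semidirect_bilinear Umod.
move: u; apply: env_ext => [||| x u IH]; try by lin.
  by rewrite co1; sw.
rewrite env_counitM env_counit_gen mul0r scale0r.
(* As ε(y a) = 0 for y in g, the map ε ⊗ id turns the semidirect action into [d], which kills the
   constants. *)
transitivity (d x (\Sw_(a, f <- co u) env_counit a *: f)).
  rewrite co_genM; move: (co u); apply: tensor_ext; try by lin.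
  move=> a f; sw; rewrite semidirect_tens // sweedlerD; last by lin.
  sw; rewrite (bilinZr db) sw_sw; last by lin.
  rewrite [X in X + _]big1 ?add0r // => p _; sw.
  by rewrite env_counitM env_counit_gen mul0r scale0r.
by rewrite IH (bilinZr db) der1 scaler0.
Qed.

(** U(g) ⊗ U(g) is a U(g)-module through the coproduct, and both sides obey the recursion given by
    the semidirect action of x on (U(g) ⊗ U(g)) ⊗ F. For the right side this rests on the Leibniz
    rule for d x (f h) and on commutativity of F. *)
Lemma co_comul u :
  \Sw_(a, f <- co u) \Sw_(a1, a2 <- env_comul a) a1 ⊗ a2 ⊗ f =
  \Sw_(u1, u2 <- env_comul u) \Sw_(a, f <- co u1) \Sw_(b, h <- co u2)
    a ⊗ b ⊗ (f * h).
Proof.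
pose m (w : U) (s : (U ⊗ U)%type) : (U ⊗ U)%type := env_comul w * s.
have mE y a b :
    m (env_gen y) (a ⊗ b) = (env_gen y * a) ⊗ b + a ⊗ (env_gen y * b).
  by rewrite /m env_comul_gen mulrDl !tensM !mul1r.
have Hm : env_module m.
  split=> [|s|w w' s]; rewrite /m.
  - split=> *; rewrite ?env_comul_linear (mulrDl, mulrDr).
      by rewrite tensor_scaleAl.
    by rewrite tensor_scaleAr.
  - by rewrite env_comul1 -tens1E mul1r.
  - by rewrite env_comulM mulrA.
have sm := semidirect_bilinear Hm; have sU := semidirect_bilinear Umod.
transitivity (\Sw_(a, f <- co u) env_comul a ⊗ f).
  apply: eq_sw => a f; rewrite -[env_comul a in RHS]sw_id.
  by rewrite (sw_map (h := fun t => t ⊗ f)) //; lin.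
move: u; apply: env_ext => [||| x u IH]; try by lin.
  by rewrite co1 env_comul1; sw; rewrite !co1 env_comul1; sw; rewrite mulr1.
transitivity (semidirect m x (\Sw_(a, f <- co u) env_comul a ⊗ f)).
  rewrite co_genM; move: (co u); apply: tensor_ext; try by lin.
  move=> a f; sw; rewrite !semidirect_tens // sweedlerD; last by lin.
  sw; congr (_ + _); sw_push; apply: eq_sw => y p; sw.
  by rewrite env_comulM.
rewrite IH (sw_map (h := semidirect m x)); last by lin.
rewrite sw_comul_genM; last by lin.
apply: eq_sw => u1 u2; rewrite !co_genM.
move: (co u1); apply: tensor_ext; try by lin.
move=> a f; move: (co u2); apply: tensor_ext; try by lin.
move=> b h; sw; rewrite !semidirect_tens // !sweedlerD; try by lin.
sw; sw_push; rewrite (imp_der dc) tens_addr [RHS]addrACA; congr (_ + _).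
rewrite -swD; apply: eq_sw => y p; sw.
by rewrite mE tens_addl !mulrA (mulFC f p).
Qed.

Lemma act_mul u f h :
  act u (f * h) = \Sw_(u1, u2 <- env_comul u) act u1 f * act u2 h.
Proof.
move: u; apply: env_ext => [||| x u IH]; try by lin.
  by rewrite env_comul1; sw; rewrite !(emod1 Hact).
rewrite act_genM IH (sw_map (h := d x)); last by lin.
rewrite sw_comul_genM; last by lin.
by apply: eq_sw => u1 u2; rewrite (imp_der dc) !act_genM.
Qed.

Lemma act_one u : act u 1 = env_counit u *: 1.
Proof.
move: u; apply: env_ext => [||| x u IH]; try by lin.
  by rewrite (emod1 Hact) env_counit1 scale1r.
by rewrite act_genM IH (bilinZr db) der1 scaler0 env_counitM env_counit_gen
  mul0r scale0r.
Qed.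

Lemma act_counit u f : counit (act u f) = env_counit u * counit f.
Proof.
move: u; apply: (@env_ext K g K^o) => [||| x u IH].
- exact: (scal_comp el (lin_bilinl f actb (@lin_id K U))).
- by move=> a u v; rewrite env_counit_scalar mulrDl -mulrA.
- by rewrite (emod1 Hact) env_counit1 mul1r.
- by rewrite act_genM (imp_counit dc) env_counitM env_counit_gen !mul0r.
Qed.

Lemma env_matched_pair : hopf_matched_pair (U := env_hopf g) act co.
Proof.
split.
- exact: env_hopfP.
- exact: HF.
- split; [|exact: act_mul|exact: act_one].
  by split; [exact: actb | exact: (emod1 Hact) | exact: (emodM Hact)].
- split; [|exact: co_comul|exact: co_counit_env].
  by split; [exact: col | exact: co_coassoc | exact: co_counit].
- exact: act_counit.
- exact: comul_act.
- exact: co1.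
- exact: co_mul.
(* The last axiom only permutes factors, in U(g) by cocommutativity and in F by commutativity. *)
- move=> u f; rewrite [LHS]sw_comulC; last by lin.
  by apply: eq_sw => u1 u2; apply: eq_sw => a p; rewrite mulFC.
Qed.

End Structure.

Lemma env_matched_pair_exists :
  exists (act : U -> F -> F) (co : U -> U ⊗ F),
    [/\ env_module act, forall x f, act (env_gen x) f = d x f, linear co,
        forall x, co (env_gen x) = \Sw_(y, p <- c x) env_gen y ⊗ p &
        hopf_matched_pair (U := env_hopf g) act co].
Proof.
have [act [Hact act_gen]] := env_moduleP (imp_rep dc).
have [L [HL Lg]] := env_moduleP (semidirect_rep env_mul_module).
have Lb := emod_bilinear HL; pose co u := L u (1 ⊗ 1).
have col : linear co by rewrite /co; lin.
have co1 : co 1 = 1 ⊗ 1 by exact: (emod1 HL).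
have co_genM x v : co (env_gen x * v) = semidirect *%R x (co v).
  by rewrite /co (emodM HL) Lg.
exists act, co; split=> // [x|]; last exact: env_matched_pair.
rewrite -[env_gen x]mulr1 co_genM co1 semidirect_tens; last exact: env_mul_module.
rewrite der1 (bilin0r (@tens_bilinear _ _ _)) addr0.
by apply: eq_sw => y p; rewrite !mulr1.
Qed.

(** As x is primitive, multiplicativity expresses co(x v) through [act], co(x), co(1) and co(v). *)
Lemma coact_multiplicative_ext (act : U -> F -> F) (co co' : U -> U ⊗ F) :
  bilinear_map act -> linear co -> linear co' -> co 1 = co' 1 ->
  coact_multiplicative (U := env_hopf g) act co ->
  coact_multiplicative (U := env_hopf g) act co' ->
  (forall x, co (env_gen x) = co' (env_gen x)) -> co =1 co'.
Proof.
move=> ab cl1 cl2 co1 coM coM' E; apply: env_ext => // x v IH.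
rewrite [LHS]coM [RHS]coM' -[env_gen x]mulr1.
rewrite [LHS]sw_comul_genM; last by lin.
rewrite [RHS]sw_comul_genM; last by lin.
by rewrite env_comul1; sw; rewrite !mulr1 E co1 IH.
Qed.

End Integration.

(** * Matched pairs of groups *)

Section Evaluation.
Variables (K : fieldType) (G : affine_group K).

Lemma polyfun_eval_scalar (x : G) : scalar (fun f : 'P(G) => f x).
Proof. by []. Qed.

Lemma polyfun_sw (V W : lmodType K) (t : V ⊗ W) (h : V -> W -> 'P(G)) x :
  (\Sw_(a, b <- t) h a b) x = \Sw_(a, b <- t) h a b x.
Proof. exact: polyfun_sum. Qed.

Lemma point_der_scalar (X : point_der G) : scalar X.
Proof. exact: point_der_linear. Qed.

Lemma point_der_sw (V W : lmodType K) (t : V ⊗ W) (h : V -> W -> 'P(G))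
    (X : point_der G) :
  X (\Sw_(a, b <- t) h a b) = \Sw_(a, b <- t) X (h a b).
Proof. exact: (big_morph X (pderD X) (pder0 X)). Qed.

Lemma point_der_sum_sw (V W : lmodType K) (t : V ⊗ W) (h : V -> W -> point_der G)
    (f : 'P(G)) :
  (\Sw_(a, b <- t) h a b) f = \Sw_(a, b <- t) h a b f.
Proof. exact: (big_morph (fun X : point_der G => X f)). Qed.

Variable V : lmodType K.

Definition ev (x : G) (t : V ⊗ 'P(G)) : V := \Sw_(v, f <- t) f x *: v.

Let ev_bilinear x : bilinear_map (fun (v : V) (f : 'P(G)) => f x *: v).
Proof.
by split=> a; [move=> v v' f | move=> v f f'];
  rewrite ?scalerDr ?scalerDl !scalerA // mulrC.
Qed.

Lemma ev_linear x : linear (ev x).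
Proof. exact: sweedler_linear. Qed.

Lemma ev_tens x v f : ev x (v ⊗ f) = f x *: v.
Proof. exact: sweedler_tens. Qed.

Lemma ev_sw (V' W' : lmodType K) (t : V' ⊗ W') (h : V' -> W' -> V ⊗ 'P(G)) x :
  ev x (\Sw_(a, b <- t) h a b) = \Sw_(a, b <- t) ev x (h a b).
Proof. exact: (sw_map _ _ (ev_linear x)). Qed.

(** The induction is on the number of terms: a term v ⊗ f with f nonzero at some x is absorbed into
    the others. Through [ev_ext], identities between tensors are then tested at points. *)
Lemma ev_inj (t : V ⊗ 'P(G)) : (forall x, ev x t = 0) -> t = 0.
Proof.
suff main n (s : seq (V * 'P(G))) : (size s <= n)%N ->
    (forall x, ev x (\sum_(p <- s) p.1 ⊗ p.2) = 0) -> \sum_(p <- s) p.1 ⊗ p.2 = 0.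
  by rewrite [t]tens_repr; apply: main (leqnn _).
elim: n s => [[] // _ _|]; first by rewrite big_nil.
move=> n IH [|[v f] s] /= ss t0; first by rewrite big_nil.
have evE (r : seq (V * 'P(G))) x :
    ev x (\sum_(p <- r) p.1 ⊗ p.2) = \sum_(p <- r) p.2 x *: p.1.
  rewrite (big_morph (ev x) (linD (ev_linear x)) (lin0 (ev_linear x))).
  by apply: eq_bigr => p _; apply: ev_tens.
have [[x fx]|f0] := pselect (exists x, f x != 0); last first.
  have fz : f = 0.
    apply: polyfun_ext => x; rewrite polyfun0; apply/eqP/negPn/negP => fx.
    by apply: f0; exists x.
  rewrite big_cons fz (bilin0r (@tens_bilinear _ _ _)) add0r.
  apply: IH => // x; rewrite evE; have := t0 x; rewrite evE big_cons /= fz.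
  by rewrite polyfun0 scale0r add0r.
(* Vanishing at x, where f is nonzero, expresses v through the other vectors. *)
have vE : v = - (\sum_(p <- s) ((p : V * 'P(G)).2 x / f x) *: p.1).
  have := t0 x; rewrite evE big_cons /= => /eqP; rewrite addr_eq0 => /eqP E.
  rewrite -[v](scalerK fx) E scalerN scaler_sumr; congr (- _).
  by apply: eq_bigr => p _; rewrite scalerA mulrC.
pose r := [seq (p.1, p.2 - ((p.2 : 'P(G)) x / f x) *: f) | p : V * 'P(G) <- s].
have -> : \sum_(p <- (v, f) :: s) p.1 ⊗ p.2 = \sum_(p <- r) p.1 ⊗ p.2.
  have lf : linear (fun w : V => w ⊗ f) by lin.
  rewrite big_cons big_map /= [X in X ⊗ _]vE.
  rewrite -sumrN (big_morph _ (linD lf) (lin0 lf)) -big_split.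
  apply: eq_bigr => p _ /=.
  rewrite -!scaleN1r scalerA !tens_scalel tens_addr scalerA !tens_scaler.
  by rewrite addrC.
apply: IH => [|y]; first by rewrite size_map.
rewrite evE big_map; apply: etrans (t0 y); rewrite evE big_cons /=.
rewrite [X in _ *: X + _]vE scalerN scaler_sumr -sumrN -big_split.
apply: eq_bigr => p _ /=.
by rewrite scalerBl scalerA [f y * _]mulrC addrC.
Qed.

Lemma ev_ext (s t : V ⊗ 'P(G)) : (forall x, ev x s = ev x t) -> s = t.
Proof.
move=> st; apply/subr0_eq/ev_inj => x.
by rewrite (linB (ev_linear x)) st subrr.
Qed.

End Evaluation.

Ltac lin_extra ::=
  match goal with
  | |- GRing.linear_for _ (@env_gen _ _) => exact: env_gen_linear
  | |- GRing.linear_for _ (fun x => env_gen _) =>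
      apply: (lin_comp (@env_gen_linear _ _))
  | |- GRing.linear_for _ (fun x => polyfun_val _ ?y) =>
      apply: (scal_comp (@polyfun_eval_scalar _ _ y))
  | |- GRing.linear_for _ (fun x => point_der_val ?X _) =>
      apply: (scal_comp (point_der_scalar X))
  | |- GRing.linear_for _ (fun x => ev ?y _) =>
      apply: (lin_comp (@ev_linear _ _ _ y))
  end.

(** * The Hopf algebra of polynomial functions *)

Section PolyFunHopfAlgebra.
Variables (K : fieldType) (G : affine_group K).
Implicit Types (f h : 'P(G)).

Lemma teval_ev (H : affine_group K) (t : 'P(G) ⊗ 'P(H)) x y :
  teval t x y = ev y t x.
Proof.
by rewrite /teval /ev polyfun_sw; apply: eq_sw => a b; rewrite polyfunZ mulrC.
Qed.

Lemma teval_ext (H : affine_group K) (s t : 'P(G) ⊗ 'P(H)) :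
  (forall x y, teval s x y = teval t x y) -> s = t.
Proof.
move=> st; apply: ev_ext => y; apply: polyfun_ext => x.
by rewrite -!teval_ev.
Qed.

Lemma teval_sw (H : affine_group K) (V W : lmodType K) (t : V ⊗ W)
    (h : V -> W -> 'P(G) ⊗ 'P(H)) x y :
  teval (\Sw_(a, b <- t) h a b) x y = \Sw_(a, b <- t) teval (h a b) x y.
Proof.
rewrite teval_ev ev_sw polyfun_sw.
by apply: eq_sw => a b; rewrite teval_ev.
Qed.

Lemma tevalM (s t : 'P(G) ⊗ 'P(G)) x y :
  teval (s * t) x y = teval s x y * teval t x y.
Proof.
move: s; elim/tensor_elim=> [a b||s s' IH IH']; last first.
- by rewrite mulrDl !tevalD mulrDl IH IH'.
- by rewrite mul0r !teval0 mul0r.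
move: t; elim/tensor_elim=> [c d||t t' IH IH']; last first.
- by rewrite mulrDr !tevalD mulrDr IH IH'.
- by rewrite mulr0 !teval0 mulr0.
by rewrite tensM !teval_tens !polyfunM mulrACA.
Qed.

Let polyfun_comul_linear : linear (@polyfun_comul K G).
Proof.
by move=> a f h; apply: teval_ext => x y; rewrite tevalD tevalZ !polyfun_comulE.
Qed.

Let polyfun_comulA f :
  \Sw_(a, b <- polyfun_comul f) polyfun_comul a ⊗ b =
  \Sw_(a, b <- polyfun_comul f) \Sw_(c, d <- polyfun_comul b) a ⊗ c ⊗ d.
Proof.
apply: ev_ext => z; apply: teval_ext => x y; rewrite !ev_sw !teval_sw.
transitivity (teval (polyfun_comul f) (x * y)%g z).
  by apply: eq_sw => a b; rewrite ev_tens tevalZ polyfun_comulE mulrC.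
rewrite polyfun_comulE -mulgA -polyfun_comulE; apply: eq_sw => a b.
rewrite ev_sw teval_sw.
have -> : b (y * z)%g = \Sw_(c, d <- polyfun_comul b) c y * d z.
  by rewrite -polyfun_comulE.
rewrite /sweedler big_distrr; apply: eq_bigr => p _ /=.
by rewrite ev_tens tevalZ teval_tens mulrA mulrC.
Qed.

(** Evaluated at points, the coalgebra and antipode laws are associativity, unit and inverse laws of
    the group. *)
Lemma polyfun_hopfP : hopf_algebra (polyfun_hopf G).
Proof.
split.
- exact: polyfun_comul_linear.
- exact: (@polyfun_eval_scalar K G 1%g).
- by move=> a f h; apply: polyfun_ext.
- exact: polyfun_comulA.
- move=> f; apply: polyfun_ext => x; rewrite polyfun_sw.
  by rewrite -[in RHS](mul1g x) -polyfun_comulE.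
- move=> f; apply: polyfun_ext => x; rewrite polyfun_sw.
  rewrite -[in RHS](mulg1 x) -polyfun_comulE.
  by apply: eq_sw => a b; rewrite polyfunZ mulrC.
- apply: teval_ext => x y; rewrite polyfun_comulE.
  by rewrite [RHS]teval_tens mulr1.
- by move=> f h; apply: teval_ext => x y; rewrite tevalM !polyfun_comulE.
- by [].
- by [].
- move=> f; apply: polyfun_ext => x; rewrite polyfun_sw.
  rewrite polyfunZ mulr1 /= /polyfun_counit -(mulVg x) -polyfun_comulE.
  exact: eq_sw.
- move=> f; apply: polyfun_ext => x; rewrite polyfun_sw.
  rewrite polyfunZ mulr1 /= /polyfun_counit -(mulgV x) -polyfun_comulE.
  exact: eq_sw.
Qed.

End PolyFunHopfAlgebra.

(* Elimination: if c is the nonzero value of the last functional at s, then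
   subtracting from the j-th functional X j its value at s divided by c times
   the last one keeps the others independent. *)
Lemma coord_closed (K : fieldType) (S T : Type) (P : (S -> K) -> Prop)
    (P_linear : forall k p q, P p -> P q -> P (fun s => k * p s + q s))
    (n : nat) (X : 'I_n -> T -> K) (a : 'I_n -> S -> K) :
  (forall b : 'I_n -> K, (forall t, \sum_i b i * X i t = 0) ->
     forall i, b i = 0) ->
  (forall t, P (fun s => \sum_i a i s * X i t)) -> forall i, P (a i).
Proof.
elim: n X a => [|n IH] X a Xfree PX i; first by case: i.
have [[t /eqP ct]|X0] := pselect (exists t, X ord_max t <> 0); last first.
  suff /eqP : (ord_max == ord_max :> 'I_n.+1)%:R = 0 :> K.
    by rewrite eqxx oner_eq0.
  apply: (Xfree (fun i => (i == ord_max)%:R)) => t.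
  rewrite (bigD1 ord_max) //= eqxx mul1r big1 ?addr0.
    by apply: contrapT => ct; apply: X0; exists t.
  by move=> j /negbTE ->; rewrite mul0r.
set c := X ord_max t in ct.
pose w := widen_ord (leqnSn n).
pose Y j u := X (w j) u - X (w j) t / c * X ord_max u.
have YE (b : 'I_n -> K) u : \sum_j b j * Y j u =
    \sum_j b j * X (w j) u - (\sum_j b j * X (w j) t) / c * X ord_max u.
  rewrite !mulr_suml -sumrB; apply: eq_bigr => j _.
  by rewrite /Y mulrBr !mulrA.
have Pa j : P (a (w j)).
  apply: (IH Y (fun j => a (w j))) => {j} [b b0 j|u].
    (* A linear relation [b] between the [Y] becomes one between the [X] with this last
       coefficient. *)
    pose b' i := if unlift ord_max i is Some j then b j
                 else - (\sum_j b j * X (w j) t) / c.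
    have b'w k : b' (w k) = b k.
      rewrite /b' (_ : w k = lift ord_max k) ?liftK //.
      by apply: val_inj; rewrite /= /bump leqNgt ltn_ord.
    rewrite -b'w; apply: Xfree => u; rewrite big_ord_recr /= -[RHS](b0 u) YE.
    rewrite {2}/b' unlift_none !mulNr; congr (_ - _).
    by apply: eq_bigr => k _; rewrite b'w.
  (* The multiple of the combination at t is chosen to cancel the last coefficient in the
     combination at u. *)
  have := P_linear (- (X ord_max u / c)) _ _ (PX t) (PX u).
  congr P; apply: funext => s; rewrite YE !big_ord_recr /= -/c.
  by field.
case: (unliftP ord_max i) => [j ->|->].
  rewrite (_ : lift _ _ = w j) //.
  by apply: val_inj; rewrite /= /bump leqNgt ltn_ord.
have P0 : P (fun=> 0).
  have := P_linear (-1) _ _ (PX t) (PX t); congr P; apply: funext => s.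
  by rewrite mulN1r addNr.
have PS : P (fun s => \sum_j a (w j) s * X (w j) t).
  elim: (index_enum _) => [|j r IHr].
    by move: P0; congr P; apply: funext => s; rewrite big_nil.
  have := P_linear (X (w j) t) _ _ (Pa j) IHr; congr P; apply: funext => s.
  by rewrite big_cons mulrC.
(* Removing the other terms at t leaves c times the last coefficient. *)
have := P_linear c^-1 _ _ (P_linear (-1) _ _ PS (PX t)) P0.
congr P; apply: funext => s; rewrite big_ord_recr /= -/c.
by field.
Qed.

(** * Differentiation of a matched pair of groups *)

Section MatchedPair.
Variables (K : fieldType) (G1 G2 : affine_group K) (M : matched_pair G1 G2).
Implicit Types (X Y : point_der G1) (psi : G2) (phi : G1) (f : 'P(G2)).

Definition ract_pull psi f : 'P(G1) :=
  \Sw_(f0, f1 <- polyfun_coaction M f) f0 psi *: f1.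

Lemma ract_pullE psi f phi : ract_pull psi f phi = f (ract M psi phi).
Proof. by rewrite polyfun_sw -polyfun_coactionE. Qed.

Lemma ract_pull1 psi f : ract_pull psi f 1%g = f psi.
Proof. by rewrite ract_pullE ract1. Qed.

Lemma ract_pull_linear psi : linear (ract_pull psi).
Proof.
by move=> a f h; apply: polyfun_ext => phi;
  rewrite polyfunD polyfunZ !ract_pullE.
Qed.

Definition act_der X f : 'P(G2) :=
  \Sw_(f0, f1 <- polyfun_coaction M f) X f1 *: f0.

Lemma act_derE X f psi : act_der X f psi = X (ract_pull psi f).
Proof.
rewrite polyfun_sw point_der_sw; apply: eq_sw => f0 f1.
by rewrite polyfunZ pderZ mulrC.
Qed.

Lemma ract_pull_act_der X f psi phi :
  ract_pull psi (act_der X f) phi = X (ltrans phi (ract_pull psi f)).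
Proof.
rewrite ract_pullE act_derE; congr (X _); apply: polyfun_ext => phi'.
by rewrite ltransE !ract_pullE ractM.
Qed.

(** By [ractM], pulling back along phi |-> psi ◁ phi turns [act_der Y] into [rconv Y]. Composites of
    such operators therefore become convolutions, whose commutator is the bracket. *)
Lemma act_der_rep : lie_rep act_der.
Proof.
split=> [|X Y f].
  split=> [a X Y f|a X f h]; apply: polyfun_ext => psi;
    rewrite polyfunD polyfunZ !act_derE //.
  by rewrite ract_pull_linear pderD pderZ.
apply: polyfun_ext => psi; rewrite -scaleN1r polyfunD polyfunZ mulN1r.
rewrite !act_derE point_der_bracketE !convolE.
by congr (X _ - Y _); apply: polyfun_ext => phi; rewrite ract_pull_act_der rconvE.
Qed.

Lemma act_der_der X f h : act_der X (f * h) = act_der X f * h + f * act_der X h.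
Proof.
apply: polyfun_ext => psi; rewrite polyfunD !polyfunM !act_derE.
rewrite (_ : ract_pull psi (f * h) = ract_pull psi f * ract_pull psi h).
  by rewrite point_derM !ract_pull1 addrC.
by apply: polyfun_ext => phi; rewrite polyfunM !ract_pullE.
Qed.

(** As e ◁ phi = e, the pulled back function is constant, and point derivations kill constants. *)
Lemma act_der_counit X f : act_der X f 1%g = 0.
Proof.
rewrite act_derE (_ : ract_pull 1%g f = f 1%g *: 1).
  rewrite pderZ; have -> : X 1 = 0; last by rewrite mulr0.
  apply: (addIr (X 1)); rewrite add0r -{3}[1]mulr1 point_derM !polyfun1.
  by rewrite mul1r mulr1.
by apply: polyfun_ext => phi; rewrite ract_pullE polyfunZ mulr1 ract_one.
Qed.

Lemma polyfun_lactE psi (f : 'P(G1)) phi :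
  polyfun_lact M psi f phi = f (lact M psi phi).
Proof. by []. Qed.

Lemma polyfun_lact1 psi (f : 'P(G1)) : polyfun_lact M psi f 1%g = f 1%g.
Proof. by rewrite /= lact_one. Qed.

Lemma lact_lieE psi X (f : 'P(G1)) : lact_lie M psi X f = X (polyfun_lact M psi f).
Proof. by []. Qed.

Lemma lact_lie_linear psi : linear (lact_lie M psi).
Proof. by move=> a X Y; apply: point_der_ext. Qed.

Lemma lact_lie_id X : lact_lie M 1%g X = X.
Proof.
apply: point_der_ext => f; rewrite lact_lieE; congr (X _).
by apply: polyfun_ext => phi; rewrite /= lact1.
Qed.

Lemma lact_lieM psi psi' X :
  lact_lie M (psi * psi')%g X = lact_lie M psi (lact_lie M psi' X).
Proof.
apply: point_der_ext => f; rewrite !lact_lieE; congr (X _).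
by apply: polyfun_ext => phi; rewrite /= lactM.
Qed.

(* The chain rule for [(psi psi') ◁ phi = (psi ◁ (psi' ▷ phi)) (psi' ◁ phi)]. *)
Lemma act_der_mul X f psi psi' : act_der X f (psi * psi')%g =
  \Sw_(f1, f2 <- polyfun_comul f)
    (act_der (lact_lie M psi' X) f1 psi * f2 psi' + f1 psi * act_der X f2 psi').
Proof.
have E : ract_pull (psi * psi')%g f = \Sw_(f1, f2 <- polyfun_comul f)
    polyfun_lact M psi' (ract_pull psi f1) * ract_pull psi' f2.
  apply: polyfun_ext => phi; rewrite ract_pullE ract_mul polyfun_sw.
  rewrite -polyfun_comulE; apply: eq_sw => f1 f2.
  by rewrite polyfunM polyfun_lactE !ract_pullE.
rewrite act_derE E point_der_sw; apply: eq_sw => f1 f2.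
by rewrite point_derM polyfun_lact1 !ract_pull1 !act_derE addrC.
Qed.

(** The function f(psi ▷ phi) is a tensor in P(G2) ⊗ P(G1), and X is applied to its second leg. *)
Lemma lact_lie_polynomial X (f : 'P(G1)) :
  exists q : 'P(G2), forall psi, q psi = lact_lie M psi X f.
Proof.
pose t : 'P(G2) ⊗ 'P(G1) := tensor_of (fun psi phi => f (lact M psi phi)).
have tE psi phi : teval t psi phi = f (lact M psi phi).
  rewrite tensor_ofP //.
  exact: (@polyfun_comp _ _ _ _ _ (fun xy : G2 * G1 => lact M xy.1 xy.2) f
    (@lact_poly _ _ _ M)).
exists (\Sw_(a, b <- t) X b *: a) => psi.
rewrite polyfun_sw lact_lieE.
have -> : polyfun_lact M psi f = \Sw_(a, b <- t) a psi *: b.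
  by apply: polyfun_ext => phi; rewrite polyfun_sw /= -tE.
rewrite point_der_sw; apply: eq_sw => a b.
by rewrite pderZ polyfunZ mulrC.
Qed.

Section Coaction.
Variable c : point_der G1 -> point_der G1 ⊗ 'P(G2).
Hypothesis cE : forall X psi, ev psi (c X) = lact_lie M psi X.

Definition lact_fun X (f : 'P(G1)) : 'P(G2) := \Sw_(Y, p <- c X) Y f *: p.

Lemma lact_funE X (f : 'P(G1)) psi : lact_fun X f psi = lact_lie M psi X f.
Proof.
rewrite -cE polyfun_sw point_der_sum_sw; apply: eq_sw => Y p.
by rewrite polyfunZ point_derZE mulrC.
Qed.

Lemma lact_fun_linear X : linear (lact_fun X).
Proof.
move=> a f h; apply: polyfun_ext => psi.
by rewrite polyfunD polyfunZ !lact_funE point_der_linear.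
Qed.

(* The chain rule for [psi ▷ (phi phi') = (psi ▷ phi) ((psi ◁ phi) ▷ phi')]. *)
Lemma convol_lact psi X Y (f : 'P(G1)) : convol X Y (polyfun_lact M psi f) =
  convol (lact_lie M psi X) (lact_lie M psi Y) f + act_der X (lact_fun Y f) psi.
Proof.
(* This is the derivative along Y in phi' at e: the second factor contributes ((psi ◁ phi) ▷ Y)(f2),
   that is, [lact_fun Y f2] pulled back along phi |-> psi ◁ phi. *)
have E : rconv Y (polyfun_lact M psi f) = \Sw_(f1, f2 <- polyfun_comul f)
    polyfun_lact M psi f1 * ract_pull psi (lact_fun Y f2).
  apply: polyfun_ext => phi; rewrite rconvE polyfun_sw.
  have -> : ltrans phi (polyfun_lact M psi f) =
      \Sw_(f1, f2 <- polyfun_comul f)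
        f1 (lact M psi phi) *: polyfun_lact M (ract M psi phi) f2.
    apply: polyfun_ext => phi'; rewrite ltransE polyfun_sw /= lact_mul.
    by rewrite -polyfun_comulE.
  rewrite point_der_sw; apply: eq_sw => f1 f2.
  by rewrite pderZ polyfunM ract_pullE lact_funE.
rewrite convolE E point_der_sw /convol.
(* Writing f as the sum of the f1(e) f2 identifies this term with the half of the product rule for X
   that differentiates the second factor. *)
have -> : act_der X (lact_fun Y f) psi = \Sw_(f1, f2 <- polyfun_comul f)
    f1 1%g * X (ract_pull psi (lact_fun Y f2)).
  rewrite act_derE -[f in LHS](_ : ltrans 1%g f = f); last first.
    by apply: polyfun_ext => phi; rewrite ltransE mul1g.
  have lf := lact_fun_linear Y; have lr := ract_pull_linear psi.
  rewrite (sw_map (h := lact_fun Y)) // (sw_map (h := ract_pull psi)) //.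
  rewrite point_der_sw; apply: eq_sw => f1 f2.
  by rewrite (linZ lf) (linZ lr) pderZ.
rewrite -swD; apply: eq_sw => f1 f2.
by rewrite point_derM polyfun_lact1 ract_pull1 lact_funE addrC.
Qed.

(** The identities are tested at points of G2, where [c] becomes the action of G2 on g1; the chain
    rules [convol_lact] and [act_der_mul] give the bracket and the coproduct. *)
Lemma point_der_imp : infinitesimal_matched_pair (F := polyfun_hopf G2) act_der c.
Proof.
have cl : linear c.
  by move=> a X Y; apply: ev_ext => psi; rewrite ev_linear !cE lact_lie_linear.
have bl := @lie_bracket_bilinear K (point_der G1).
have ab := rep_bilinear act_der_rep.
split.
- exact: act_der_rep.
- exact: act_der_der.
- exact: cl.
(* At psi and psi', both sides are (psi psi') ▷ X. *)
- move=> X; apply: ev_ext => psi'; apply: ev_ext => psi.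
  rewrite 2!(ev_sw _ _ psi') 2!(ev_sw _ _ psi).
  transitivity (lact_lie M (psi * psi')%g X).
    rewrite lact_lieM -(cE X psi') (sw_map (h := lact_lie M psi)); last first.
      exact: lact_lie_linear.
    apply: eq_sw => Y p.
    by rewrite ev_tens (linZ (@ev_linear _ _ _ psi)) cE (linZ (lact_lie_linear psi)).
  rewrite -cE; apply: eq_sw => Y p.
  rewrite (ev_sw _ _ psi') (ev_sw _ _ psi) -polyfun_comulE teval_ev polyfun_sw.
  rewrite (sw_map (M := K^o) (h := fun k : K^o => k *: Y)); last first.
    by move=> a k k'; rewrite scalerDl scalerA.
  apply: eq_sw => p1 p2.
  by rewrite ev_tens (linZ (@ev_linear _ _ _ psi)) ev_tens polyfunZ scalerA.
- by move=> X; rewrite -[RHS]lact_lie_id -cE; apply: eq_sw.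
(* At psi and on a function f, this is [convol_lact] for X and Y minus the same for Y and X. *)
- move=> X Y; apply: ev_ext => psi; have evl := @ev_linear _ G2 (point_der G1) psi.
  rewrite (linB evl) (linD evl) cE !ev_sw.
  have E1 : \Sw_(X0, p <- c X) ev psi (\Sw_(Y0, q <- c Y)
      lie_bracket X0 Y0 ⊗ (p * q)) =
      lie_bracket (lact_lie M psi X) (lact_lie M psi Y).
    rewrite -[in RHS](cE X).
    rewrite (sw_map (h := fun Z => lie_bracket Z (lact_lie M psi Y))); last by lin.
    apply: eq_sw => X0 p.
    rewrite -cE (sw_map (h := lie_bracket (p psi *: X0))); last by lin.
    rewrite ev_sw; apply: eq_sw => Y0 q.
    by rewrite ev_tens (bilinZl bl) (bilinZr bl) scalerA.
  have E2 X' Y' (f : 'P(G1)) : (\Sw_(Y0, q <- c Y') ev psi (Y0 ⊗ act_der X' q)) f =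
      act_der X' (lact_fun Y' f) psi.
    rewrite point_der_sum_sw (sw_map (h := act_der X')); last by lin.
    rewrite polyfun_sw; apply: eq_sw => Y0 q.
    by rewrite ev_tens (bilinZr ab) polyfunZ point_derZE mulrC.
  rewrite E1; apply: point_der_ext => f.
  rewrite point_derBE point_derDE !E2 !point_der_bracketE.
  rewrite lact_lieE point_der_bracketE !convol_lact.
  by ring.
- move=> X f; apply: teval_ext => psi psi'.
  rewrite polyfun_comulE act_der_mul teval_sw; apply: eq_sw => f1 f2.
  rewrite tevalD teval_tens; congr (_ + _).
  rewrite teval_sw -cE act_derE point_der_sum_sw.
  rewrite [LHS]big_distrl; apply: eq_bigr => q _.
  by rewrite teval_tens polyfunM act_derE point_derZE /= mulrAC mulrC mulrCA mulrA.
- exact: act_der_counit.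
Qed.

End Coaction.
End MatchedPair.

(** * Coordinates in a basis of the Lie algebra, and the matched pair of Hopf algebras *)

Section Basis.
Variables (K : fieldType) (G1 G2 : affine_group K) (M : matched_pair G1 G2).
Variables (n : nat) (X : 'I_n -> point_der G1).
Hypothesis X_basis : is_basis X.

Lemma point_der_sum I (r : seq I) (F : I -> point_der G1) (t : 'P(G1)) :
  (\sum_(i <- r) F i) t = \sum_(i <- r) F i t.
Proof. exact: (big_morph (fun Y : point_der G1 => Y t)). Qed.

Lemma basis_span Y : exists a : 'I_n -> K, Y = \sum_i a i *: X i.
Proof. by have [a [aE _]] := X_basis Y; exists a. Qed.

Lemma basis_free (b : 'I_n -> K) :
  (forall t : 'P(G1), \sum_i b i * X i t = 0) -> forall i, b i = 0.
Proof.
move=> b0 i; have [a [_ aU]] := X_basis 0.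
rewrite -(aU b); last first.
  by apply: point_der_ext => t; rewrite point_der_sum b0.
by rewrite (aU (fun=> 0)) // big1 // => j _; rewrite scale0r.
Qed.

(** Applied to any function t, the expansion of psi ▷ X i is polynomial in psi by
    [lact_lie_polynomial]. As the X j are independent functionals, [coord_closed] makes each
    coordinate polynomial. *)
Lemma lact_lie_coord : exists f : 'I_n -> 'I_n -> 'P(G2), forall psi i,
  lact_lie M psi (X i) = \sum_j f j i psi *: X j.
Proof.
have [a aE] := choice basis_span.
suff /choice[f fE] : forall ij : 'I_n * 'I_n,
    exists p : 'P(G2), forall psi, p psi = a (lact_lie M psi (X ij.1)) ij.2.
  exists (fun j i => f (i, j)) => psi i.
  by rewrite [LHS]aE; apply: eq_bigr => j _; rewrite fE.
move=> [i j] /=; move: j.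
apply: (@coord_closed K G2 'P(G1)
  (fun h => exists p : 'P(G2), forall psi, p psi = h psi) _ n
  (fun j t => X j t) (fun j psi => a (lact_lie M psi (X i)) j)).
- move=> k p q [p' pE] [q' qE]; exists (k *: p' + q') => psi.
  by rewrite polyfunD polyfunZ pE qE.
- exact: basis_free.
move=> t; have [q qE] := lact_lie_polynomial M (X i) t; exists q => psi.
by rewrite qE [in LHS](aE (lact_lie M psi (X i))) point_der_sum.
Qed.

Lemma env_polyfun_matched_pair : exists f : 'I_n -> 'I_n -> 'P(G2),
    (forall (psi : G2) (i : 'I_n),
       lact_lie M psi (X i) = \sum_j f j i psi *: X j) /\
    exists (act : env (point_der G1) -> 'P(G2) -> 'P(G2))
           (co : env (point_der G1) -> env (point_der G1) ⊗ 'P(G2)),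
    [/\ determined_action M act,
        forall act', determined_action M act' ->
          forall u p, act' u p = act u p,
        extended_coaction X f act co,
        forall co', extended_coaction X f act co' -> forall u, co' u = co u &
        hopf_matched_pair (U := env_hopf (point_der G1)) (F := polyfun_hopf G2)
          act co].
Proof.
have [f fE] := lact_lie_coord; exists f; split=> //.
have [a aE] := choice basis_span.
(* [c] extends the prescribed values on the basis linearly, and its value at psi is psi ▷ Y, as
   [point_der_imp] requires. *)
pose c Y : point_der G1 ⊗ 'P(G2) :=
  \sum_i a Y i *: \sum_j X j ⊗ f j i.
have cE Y psi : ev psi (c Y) = lact_lie M psi Y.
  have evl := @ev_linear _ G2 (point_der G1) psi.
  have ll := lact_lie_linear M psi.
  rewrite (lin_bigsum _ _ evl) [in RHS](aE Y) (lin_bigsum _ _ ll).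
  apply: eq_bigr => i _.
  rewrite (linZ evl) (linZ ll) fE (lin_bigsum _ _ evl); congr (_ *: _).
  by apply: eq_bigr => j _; rewrite ev_tens.
have cX i : c (X i) = \sum_j X j ⊗ f j i.
  apply: ev_ext => psi; rewrite cE fE (lin_bigsum _ _ (@ev_linear _ _ _ psi)).
  by apply: eq_bigr => j _; rewrite ev_tens.
have [act [co [Hact act_gen col co_genE HM]]] :=
  env_matched_pair_exists (polyfun_hopfP G2) (@mulrC 'P(G2)) (point_der_imp cE).
have co_gen i : co (env_gen (X i)) = \sum_j env_gen (X j) ⊗ f j i.
  rewrite co_genE cX [LHS](lin_bigsum _ _ (sweedler_linear _)); last by lin.
  by apply: eq_bigr => j _; sw.
exists act, co; split=> //.
- split=> [|Y p]; last exact: act_gen.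
  by split; [exact: emod_bilinear Hact | exact: (emod1 Hact) | exact: (emodM Hact)].
- move=> act' [[ab1 a1 aM] ag]; apply: env_module_ext => [||Y p].
  + by split.
  + exact: Hact.
  + by rewrite ag act_gen.
- by split=> //; [exact: hmp_coact1 HM | exact: hmp_coactM HM].
(* Linearity carries agreement from the basis to all of g1, as [coact_multiplicative_ext]
   requires. *)
- move=> co' [col' co_gen' co1' coM'].
  have actb := emod_bilinear Hact.
  apply: (coact_multiplicative_ext (F := polyfun_hopf G2) actb col' col _ coM'
    (hmp_coactM HM)) => [|Y]; first by rewrite co1' (hmp_coact1 HM).
  have genl := @env_gen_linear K (point_der G1).
  rewrite (aE Y) (lin_bigsum _ _ genl) (lin_bigsum _ _ col') (lin_bigsum _ _ col).
  apply: eq_bigr => i _.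
  by rewrite (linZ genl) (linZ col') (linZ col) co_gen co_gen'.
Qed.
End Basis.

Theorem theorem2p22 (R : realType) (G1 G2 : affine_group R[i])
    (G1_connected : zariski_connected G1) (G2_connected : zariski_connected G2)
    (M : matched_pair G1 G2)
    (n : nat) (X : 'I_n -> point_der G1) (X_basis : is_basis X) :
  exists f : 'I_n -> 'I_n -> 'P(G2),
    (forall (psi : G2) (i : 'I_n),
       lact_lie M psi (X i) = \sum_j f j i psi *: X j) /\
    exists (act : env (point_der G1) -> 'P(G2) -> 'P(G2))
           (co : env (point_der G1) -> env (point_der G1) ⊗ 'P(G2)),
    [/\ determined_action M act,
        forall act', determined_action M act' ->
          forall u p, act' u p = act u p,
        extended_coaction X f act co,
        forall co', extended_coaction X f act co' -> forall u, co' u = co u &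
        hopf_matched_pair (U := env_hopf (point_der G1)) (F := polyfun_hopf G2)
          act co].
Proof. exact: env_polyfun_matched_pair. Qed.
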